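(* If $\mathcal{C}$ is a permutation class that is a proper subclass of $\mathcal{C}_{1,1}\cap\mathrm{Av}(3142)$, then $\mathcal{C}$-Pattern PPM can be solved in polynomial time.
   Context: A permutation of size $n$ is a bijection of $[n]$ to itself, written as a sequence $\pi(1),\dots,\pi(n)$. A permutation $\tau$ of size $n$ contains a permutation $\pi$ of size $k$ if there are indices $i_1<\dots<i_k$ with $\tau(i_a)<\tau(i_b)$ iff $\pi(a)<\pi(b)$ for all $a,b\in[k]$; otherwise $\tau$ avoids $\pi$. $\mathrm{Av}(3142)$ is the set of permutations avoiding $3142$, and $\mathcal{C}_{1,1}$ is the set of permutations that can be partitioned into one increasing and one decreasing (possibly empty) subsequence. A permutation class is a set of permutations closed under containment (every permutation contained in a member is a member). A proper subclass is a permutation class contained in and different from the given class. The problem $\mathcal{C}$-Pattern PPM has as input a pattern $\pi\in\mathcal{C}$ of size $k$ and an arbitrary permutation $\tau$ of size $n\ge k$, and asks whether $\tau$ contains $\pi$. *)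

(* Defs.v *)
From mathcomp Require Import all_boot all_order all_fingroup.

Set Implicit Arguments.
Unset Strict Implicit.
Unset Printing Implicit Defensive.

(** A permutation of size n is an element of 'S_n, i.e. a bijection of
    {0, ..., n-1}; positions and values are shifted down by one with respect to
    one-line notation on [n]. *)

Definition contains (n k : nat) (tau : 'S_n) (pi : 'S_k) : Prop :=
  exists f : 'I_k -> 'I_n,
    (forall a b : 'I_k, a < b -> f a < f b) /\
    (forall a b : 'I_k, tau (f a) < tau (f b) <-> pi a < pi b).

Definition avoids (n k : nat) (tau : 'S_n) (pi : 'S_k) : Prop :=
  ~ contains tau pi.

Definition perm_set := forall n : nat, 'S_n -> Prop.

Definition perm_class (C : perm_set) : Prop :=
  forall (n k : nat) (tau : 'S_n) (pi : 'S_k),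
    C n tau -> contains tau pi -> C k pi.

Definition perm_subset (C D : perm_set) : Prop :=
  forall (n : nat) (pi : 'S_n), C n pi -> D n pi.

Definition proper_subclass (C D : perm_set) : Prop :=
  [/\ perm_class C, perm_subset C D & ~ perm_subset D C].

Definition Av (k : nat) (pi : 'S_k) : perm_set :=
  fun n tau => avoids tau pi.

Definition perm_setI (C D : perm_set) : perm_set :=
  fun n pi => C n pi /\ D n pi.

Definition increasing_on (n : nat) (pi : 'S_n) (A : {set 'I_n}) : Prop :=
  forall i j : 'I_n, i \in A -> j \in A -> i < j -> pi i < pi j.

Definition decreasing_on (n : nat) (pi : 'S_n) (A : {set 'I_n}) : Prop :=
  forall i j : 'I_n, i \in A -> j \in A -> i < j -> pi j < pi i.

Definition C11 : perm_set :=
  fun n pi => exists A : {set 'I_n}, increasing_on pi A /\ decreasing_on pi (~: A).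

Definition fun3142 (i : 'I_4) : 'I_4 := inord (nth 0 [:: 2; 0; 3; 1] i).

Lemma fun3142_inj : injective fun3142.
Proof.
have lt4 (i : 'I_4) : nth 0 [:: 2; 0; 3; 1] i < 4.
  by case: i => [[|[|[|[|]]]]].
move=> i j /(congr1 val); rewrite /= !inordK // => E; apply: val_inj.
case: i j E => [i /= Hi] [j /= Hj].
by do 4?[case: i Hi => [|i] Hi //]; do 4?[case: j Hj => [|j] Hj //].
Qed.

Definition p3142 : 'S_4 := perm fun3142_inj.

Lemma p3142E : [seq (p3142 i).+1 | i : 'I_4] = [:: 3; 1; 4; 2].
Proof.
rewrite /image_mem -[RHS]/[seq (nth 0 [:: 2; 0; 3; 1] i).+1 | i <- iota 0 4].
rewrite -val_enum_ord -map_comp; apply: eq_map => i /=.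
by rewrite permE inordK //; case: i => [[|[|[|[|]]]]].
Qed.

(** Polynomial time is measured on a deterministic random access machine with
    countably many registers holding natural numbers, indirect addressing, and
    unit cost per instruction.  The arithmetic is limited to addition and
    truncated subtraction (no multiplication), so that register contents have
    at most polynomially many bits after polynomially many steps and the model
    is polynomially equivalent to Turing machines. *)

Inductive instr : Type :=
  | Const of nat & nat          (* R[i] := c *)
  | Add of nat & nat & nat      (* R[i] := R[j] + R[l] *)
  | Sub of nat & nat & nat      (* R[i] := max(R[j] - R[l], 0) *)
  | Fetch of nat & nat           (* R[i] := R[R[j]] *)
  | Store of nat & nat          (* R[R[i]] := R[j] *)
  | Jump of nat                 (* goto p *)
  | JumpZero of nat & nat.      (* if R[i] = 0 then goto p *)

Definition program := seq instr.
Definition memory := nat -> nat.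
Definition state := (nat * memory)%type.

Definition write (m : memory) (a v : nat) : memory :=
  fun b => if b == a then v else m b.

Definition exec (c : instr) (s : state) : state :=
  let: (pc, m) := s in
  match c with
  | Const i v => (pc.+1, write m i v)
  | Add i j l => (pc.+1, write m i (m j + m l))
  | Sub i j l => (pc.+1, write m i (m j - m l))
  | Fetch i j => (pc.+1, write m i (m (m j)))
  | Store i j => (pc.+1, write m (m i) (m j))
  | Jump p => (p, m)
  | JumpZero i p => (if m i == 0 then p else pc.+1, m)
  end.

(** The machine halts when the program counter leaves the program; a halted
    state is a fixed point of [step]. *)
Definition halted (P : program) (s : state) : bool := size P <= s.1.

Definition step (P : program) (s : state) : state :=
  if halted P s then s else exec (nth (Jump 0) P s.1) s.

Definition init_state (w : seq nat) : state := (0, nth 0 w).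

Definition accepting (s : state) : Prop := s.2 0 != 0.

(** [psize] measures the size of an instance; [pcode] is the content of the
    registers R[0], R[1], ... at the start, all other registers being 0. *)
Record decision_problem := DecisionProblem {
  instance : Type;
  psize : instance -> nat;
  pcode : instance -> seq nat;
  answer : instance -> Prop
}.

Definition decides_within (P : program) (D : decision_problem)
    (T : nat -> nat) : Prop :=
  forall x : instance D, exists2 t : nat, t <= T (psize x) &
    let s := iter t (step P) (init_state (pcode x)) in
    halted P s /\ (accepting s <-> answer x).

Definition polynomial_time (D : decision_problem) : Prop :=
  exists (P : program) (c d : nat), decides_within P D (fun n => c * n.+1 ^ d).

(** Only patterns belonging to C are instances, so a program solving the
    problem need not recognise membership in C. *)
Record ppm_instance (C : perm_set) := PPMInstance {
  ppm_k : nat;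
  ppm_n : nat;
  ppm_pattern : 'S_ppm_k;
  ppm_text : 'S_ppm_n;
  ppm_pattern_in : C ppm_k ppm_pattern;
  ppm_le : ppm_k <= ppm_n
}.

Definition ppm_code (C : perm_set) (x : ppm_instance C) : seq nat :=
  [:: ppm_k x, ppm_n x &
    [seq nat_of_ord (ppm_pattern x i) | i : 'I_(ppm_k x)] ++
    [seq nat_of_ord (ppm_text x i) | i : 'I_(ppm_n x)]].

(** Since the pattern has size k <= n, every register of the input holds at
    most n and the input has length at most 2n + 2, so polynomial in n and
    polynomial in the bit length of the input mean the same. *)
Definition pattern_PPM (C : perm_set) : decision_problem :=
  @DecisionProblem (ppm_instance C) (fun x => ppm_n x) (@ppm_code C)
    (fun x => contains (ppm_text x) (ppm_pattern x)).

(* Main.v *)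
Require Import Defs.
From mathcomp Require Import all_boot all_order all_fingroup.
From mathcomp Require Import zify.
From Stdlib Require Import Classical_Prop.

Set Implicit Arguments.
Unset Strict Implicit.
Unset Printing Implicit Defensive.

(** A permutation of C11 consists of four monotone arms around a centre.  Walking around the centre
    and always stepping to the next arm towards the centre cuts the arms into blocks B_1, B_2, ...;
    since 3142 is avoided, every full turn gets strictly closer to the centre, so the walk ends, and
    the result is a spiral staircase: only consecutive blocks interleave, arbitrarily, all other
    relations are forced.

    Let sigma be a member of the big class that is missing in C.  In a window of boundedly many
    consecutive blocks of a pattern, follow all greedy zigzags that always move to the lowest point of
    an adjacent block above the current one.  If none of them gets stuck within a bounded number of
    steps, their highest points form a grid into which sigma embeds.  Otherwise a stuck zigzag is a
    bounded separator between the blocks before and after it.  Hence the patterns in C have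
    separators at bounded distances, the pieces in between are swept by a linear extension of the
    staircase order, and the graph joining points of consecutive position or consecutive value has
    bounded treewidth w.  For such patterns w-consistency (the existential w-pebble game) decides
    containment; it is computed by eliminating w-tuples of pairs until nothing changes. *)

(** * Compiling expressions and loops to the random access machine *)

(** The program knows nothing of spirals or cuts: it depends on C only through the number w, and the
    decomposition occurs only in the proof that consistency is complete. The grid works because an
    unstuck zigzag can always go on: from the highest point of a block reached in s steps, one more
    step leads to a higher point in either neighbouring block of the window. A stuck zigzag
    separates because a pair of consecutive points that avoids it can cross only at points above its
    end in the block to be entered next, and there are none. The staircase order does not see every
    edge of the pattern graph: a point on one side of the centre can be next, in position or value,
    to a point of another turn or of the opposite side. Such edges join extremal points of blocks at
    most five apart, so a separator is completed by the extremal points of the blocks around it, two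
    per block. The machine offers neither multiplication nor a free register, which explains the
    counting sums and the relocation of the input. *)

Definition code_at (P : program) (pc : nat) (c : program) : Prop :=
  pc + size c <= size P /\
  forall i, i < size c -> nth (Jump 0) P (pc + i) = nth (Jump 0) c i.

Lemma code_at_cat P pc c1 c2 :
  code_at P pc (c1 ++ c2) -> code_at P pc c1 /\ code_at P (pc + size c1) c2.
Proof.
move=> [sz H]; rewrite size_cat in sz H; split; split; first lia.
- by move=> i hi; rewrite H ?nth_cat ?hi //; lia.
- lia.
by move=> i hi; rewrite -addnA H ?nth_cat; [rewrite ltnNge leq_addr addKn | lia].
Qed.

Definition reaches (P : program) (t : nat) (s s' : state) : Prop :=
  exists2 t', t' <= t & iter t' (step P) s = s'.

Lemma reaches_refl P s : reaches P 0 s s.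
Proof. by exists 0. Qed.

Lemma reaches_trans P t1 t2 s1 s2 s3 :
  reaches P t1 s1 s2 -> reaches P t2 s2 s3 -> reaches P (t1 + t2) s1 s3.
Proof.
move=> [u1 le1 <-] [u2 le2 <-]; exists (u2 + u1); first lia.
by rewrite iterD.
Qed.

Lemma reaches_leq P t t' s s' : t <= t' -> reaches P t s s' -> reaches P t' s s'.
Proof. by move=> le [u le1 <-]; exists u => //; lia. Qed.

Lemma reaches_step P pc c cs m s' t :
  code_at P pc (c :: cs) -> reaches P t (exec c (pc, m)) s' ->
  reaches P t.+1 (pc, m) s'.
Proof.
move=> [sz H] [u le <-]; exists u.+1 => //; rewrite iterSr; congr iter.
have /= := H 0 isT; rewrite addn0 => E.
rewrite /step /halted /= E ifF //; move: sz => /=; lia.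
Qed.

Lemma code_at_behead P pc c cs : code_at P pc (c :: cs) -> code_at P pc.+1 cs.
Proof. by move=> /(@code_at_cat P pc [:: c] cs) [_]; rewrite addn1. Qed.

(* Variables are de Bruijn levels; a sum ranges over the values below variable 1 or 2. *)
Inductive expr : Type :=
  | EVar of nat
  | ECst of nat
  | EAdd of expr & expr
  | ESub of expr & expr
  | ELoad of expr
  | EIfz of expr & expr & expr
  | ESum of bool & expr.

Fixpoint eval (rho : seq nat) (h : memory) (e : expr) : nat :=
  match e with
  | EVar i => nth 0 rho i
  | ECst c => c
  | EAdd a b => eval rho h a + eval rho h b
  | ESub a b => eval rho h a - eval rho h b
  | ELoad a => h (eval rho h a)
  | EIfz a b c => if eval rho h a == 0 then eval rho h b else eval rho h c
  | ESum v a => \sum_(j < nth 0 rho v.+1) eval (rcons rho j) h a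
  end.

(** [env] lists the registers of the variables, [d] is the target, and the registers from [d] up to
    the heap at [SC] are free. Jumps are absolute, so the code depends on its own address [pc]. *)
Fixpoint compile (SC : nat) (env : seq nat) (e : expr) (d pc : nat) : program :=
  match e with
  | EVar i =>
      Const d 0 :: if i < size env then [:: Add d d (nth 0 env i)] else [::]
  | ECst c => [:: Const d c]
  | EAdd a b =>
      let ca := compile SC env a d pc in
      ca ++ compile SC env b d.+1 (pc + size ca) ++ [:: Add d d d.+1]
  | ESub a b =>
      let ca := compile SC env a d pc in
      ca ++ compile SC env b d.+1 (pc + size ca) ++ [:: Defs.Sub d d d.+1]
  | ELoad a =>
      compile SC env a d pc ++ [:: Const d.+1 SC; Add d d d.+1; Fetch d d]
  | EIfz a b c =>
      let ca := compile SC env a d pc in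
      let cc := compile SC env c d (pc + size ca).+1 in
      let pb := (pc + size ca).+2 + size cc in
      let cb := compile SC env b d pb in
      ca ++ [:: JumpZero d pb] ++ cc ++ [:: Jump (pb + size cb)] ++ cb
  | ESum v a =>
      let ca := compile SC (rcons env d.+1) a d.+2 pc.+4 in
      [:: Const d 0; Const d.+1 0; Defs.Sub d.+2 (nth 0 env v.+1) d.+1;
          JumpZero d.+2 (pc + 8 + size ca)] ++ ca ++
      [:: Add d d d.+2; Const d.+2 1; Add d.+1 d.+1 d.+2; Jump pc.+2]
  end.

(* Number of registers, counted from the target register on, that the compiled code may modify. *)
Fixpoint height (e : expr) : nat :=
  match e with
  | EVar _ | ECst _ => 1
  | EAdd a b | ESub a b => (maxn (height a) (height b)).+1
  | ELoad a => (height a).+1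
  | EIfz a b c => maxn (height a) (maxn (height b) (height c))
  | ESum _ a => (height a).+3
  end.

Fixpoint cost (B : nat) (e : expr) : nat :=
  match e with
  | EVar _ => 2
  | ECst _ => 1
  | EAdd a b | ESub a b => cost B a + cost B b + 1
  | ELoad a => cost B a + 3
  | EIfz a b c => cost B a + cost B b + cost B c + 2
  | ESum _ a => B * (cost B a + 6) + 4
  end.

Definition env_ok (env rho : seq nat) (d : nat) (m : memory) : Prop :=
  [/\ size env = size rho, 2 < size env,
      forall i, i < size env -> nth 0 env i < d &
      forall i, i < size env -> m (nth 0 env i) = nth 0 rho i].

Definition heap_ok (SC : nat) (h m : memory) : Prop := forall i, m (SC + i) = h i.

Definition same_outside (d d' : nat) (m m' : memory) : Prop :=
  forall a, (a < d) || (d' <= a) -> m' a = m a.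

Lemma same_outside_trans d d' m1 m2 m3 :
  same_outside d d' m1 m2 -> same_outside d d' m2 m3 -> same_outside d d' m1 m3.
Proof. by move=> H1 H2 a ha; rewrite H2 ?H1. Qed.

Lemma same_outside_sub d d' e e' m m' :
  d <= e -> e' <= d' -> same_outside e e' m m' -> same_outside d d' m m'.
Proof. by move=> h1 h2 H a ha; rewrite H //; lia. Qed.

Lemma same_outside_write d d' m a v :
  d <= a < d' -> same_outside d d' m (write m a v).
Proof. by move=> h b hb; rewrite /write ifF //; lia. Qed.

Lemma env_ok_same env rho d d1 d' m m' :
  d <= d1 -> same_outside d d' m m' -> env_ok env rho d m -> env_ok env rho d1 m'.
Proof.
move=> le H [h1 h2 h3 h4]; split=> // i hi; have := h3 i hi; first lia.
by move=> lt; rewrite H ?h4 ?lt.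
Qed.

Lemma heap_ok_same SC h d d' m m' :
  d' <= SC -> same_outside d d' m m' -> heap_ok SC h m -> heap_ok SC h m'.
Proof. by move=> le H hm i; rewrite H ?hm //; lia. Qed.

Lemma env_ok_gt0 env rho d m : env_ok env rho d m -> 0 < d.
Proof. by move=> [_ h2 h3 _]; have := h3 0 (ltnW (ltnW h2)); lia. Qed.

Lemma env_ok_rcons env rho d d1 m a v :
  env_ok env rho d m -> d <= d1 -> a < d1 -> m a = v ->
  env_ok (rcons env a) (rcons rho v) d1 m.
Proof.
move=> [h1 h2 h3 h4] le lt E; split; rewrite ?size_rcons; [by rewrite h1|lia|..].
  move=> i hi; rewrite nth_rcons; case: (ltnP i (size env)) => [/h3|_]; first lia.
  by case: eqP => // _; lia.
move=> i hi; rewrite !nth_rcons -h1; case: (ltnP i (size env)) => [/h4 //|le2].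
by have -> : i == size env by lia.
Qed.

Lemma writeE m a v : write m a v a = v.
Proof. by rewrite /write eqxx. Qed.

Lemma writeNE m a v b : b != a -> write m a v b = m b.
Proof. by rewrite /write => /negPf->. Qed.

Definition computes SC h env rho B e (d : nat) :=
  forall P pc m,
  code_at P pc (compile SC env e d pc) -> env_ok env rho d m -> heap_ok SC h m ->
  d + height e <= SC -> nth 0 rho 1 <= B -> nth 0 rho 2 <= B ->
  exists m', [/\ reaches P (cost B e) (pc, m) (pc + size (compile SC env e d pc), m'),
     m' d = eval rho h e & same_outside d (d + height e) m m'].

Lemma height_gt0 e : 0 < height e.
Proof. by elim: e => //= a h1 b h2 c h3; lia. Qed.

(** The final instruction stays abstract, so that sums and differences share the argument. The
    second operand is computed from [d.+1] on, which leaves the first one in [d] intact. *)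
Lemma computes_binop SC h env rho B d a b P pc m I :
  computes SC h env rho B a d -> computes SC h env rho B b d.+1 ->
  let ca := compile SC env a d pc in
  let c := ca ++ compile SC env b d.+1 (pc + size ca) ++ [:: I] in
  code_at P pc c -> env_ok env rho d m -> heap_ok SC h m ->
  d + (maxn (height a) (height b)).+1 <= SC -> nth 0 rho 1 <= B -> nth 0 rho 2 <= B ->
  exists m', [/\ reaches P (cost B a + cost B b + 1) (pc, m) (exec I ((pc + size c).-1, m')),
     m' d = eval rho h a, m' d.+1 = eval rho h b &
     same_outside d (d + (maxn (height a) (height b)).+1) m m'].
Proof.
move=> IHa IHb ca c hc he hh hd hB1 hB2.
have [ha /code_at_cat [hb hadd]] := code_at_cat hc.
have [|m1 [r1 v1 s1]] := IHa _ _ _ ha he hh _ hB1 hB2; first lia.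
have s1' : same_outside d (d + (maxn (height a) (height b)).+1) m m1.
  by apply: same_outside_sub s1; lia.
have [|||m2 [r2 v2 s2]] := IHb _ _ m1 hb _ _ _ hB1 hB2.
+ by apply: env_ok_same s1 he.
+ by apply: heap_ok_same s1' hh; lia.
+ lia.
exists m2; split=> //.
+ apply: reaches_trans (reaches_trans r1 r2) _.
  rewrite /c !size_cat /= (_ : _.-1 = pc + size ca + size (compile SC env b d.+1 (pc + size ca))); last lia.
  exact: reaches_step hadd (reaches_refl _ _).
+ by rewrite s2 ?v1 ?ltnSn.
by apply: same_outside_trans s1' _; apply: same_outside_sub s2; lia.
Qed.

Lemma compile_correct SC h e env rho B d : computes SC h env rho B e d.
Proof.
elim: e env rho d => [i|c|a IHa b IHb|a IHa b IHb|a IHa|a IHa b IHb c IHc|v a IHa]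
  env rho d P pc m /= hc he hh hd hB1 hB2.
- have d0 := env_ok_gt0 he.
  have [h1 _ h3 h4] := he; move: hc; case: ifP => hi hc; last first.
    eexists; split.
    + apply: (reaches_step hc) => /=; rewrite addn1.
      exact: (reaches_leq _ (reaches_refl _ _)).
    + by rewrite writeE nth_default // -h1 leqNgt hi.
    + by apply: same_outside_write; lia.
  eexists; split.
  + apply: (reaches_step hc) => /=; have hc1 := code_at_behead hc.
    apply: (reaches_step hc1) => /=; rewrite addn2; exact: reaches_refl.
  + rewrite !writeE add0n writeNE ?h4 //; have := h3 _ hi; lia.
  + move=> x hx; rewrite !writeNE //; lia.
- eexists; split.
  + apply: (reaches_step hc) => /=; rewrite addn1; exact: reaches_refl.
  + by rewrite writeE.
  + by apply: same_outside_write; lia.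
- have [m1 [r1 v1 v2 s1]] := computes_binop (IHa env rho d) (IHb env rho d.+1) hc he hh hd hB1 hB2.
  exists (write m1 d (m1 d + m1 d.+1)); split; [|by rewrite writeE v1 v2|].
  + by move: r1 => /=; rewrite (_ : _.-1.+1 = pc + size (compile SC env a d pc ++ compile SC env b d.+1 (pc + size (compile SC env a d pc)) ++ [:: Add d d d.+1])) //; rewrite !size_cat /=; lia.
  + by apply: same_outside_trans s1 _; apply: same_outside_write; lia.
- have [m1 [r1 v1 v2 s1]] := computes_binop (IHa env rho d) (IHb env rho d.+1) hc he hh hd hB1 hB2.
  exists (write m1 d (m1 d - m1 d.+1)); split; [|by rewrite writeE v1 v2|].
  + by move: r1 => /=; rewrite (_ : _.-1.+1 = pc + size (compile SC env a d pc ++ compile SC env b d.+1 (pc + size (compile SC env a d pc)) ++ [:: Defs.Sub d d d.+1])) //; rewrite !size_cat /=; lia.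
  + by apply: same_outside_trans s1 _; apply: same_outside_write; lia.
- have hg := height_gt0 a; have [ha hb] := code_at_cat hc.
  have [|m1 [r1 v1 s1]] := IHa _ _ _ _ _ _ ha he hh _ hB1 hB2; first lia.
  eexists; split.
  + apply: reaches_trans r1 _.
    apply: (reaches_step hb) => /=; have {}hb := code_at_behead hb.
    apply: (reaches_step hb) => /=; have {}hb := code_at_behead hb.
    apply: (reaches_step hb) => /=.
    by rewrite size_cat addnA /= !addnS addn0; exact: reaches_refl.
  + rewrite !writeE (writeNE _ _ (_ : d != d.+1)); last lia.
    rewrite v1 !writeNE ?[_ + SC]addnC ?s1 ?hh //; have := height_gt0 a; lia.
  + apply: same_outside_trans (_ : same_outside _ _ m m1) _.
      by apply: same_outside_sub s1; lia.
    by move=> x hx; rewrite !writeNE //; lia.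
- have [ha hj] := code_at_cat hc.
  have [hcc hj2] := code_at_cat (code_at_behead hj); have hb := code_at_behead hj2.
  have [|m1 [r1 v1 s1]] := IHa _ _ _ _ _ _ ha he hh _ hB1 hB2; first lia.
  rewrite -addSn in hb.
  set pb := (pc + _).+2 + _ in hc hj hj2 hb *.
  have s1' : same_outside d (d + (maxn (height a) (maxn (height b) (height c)))) m m1.
    by apply: same_outside_sub s1; lia.
  have he1 : env_ok env rho d m1 by apply: env_ok_same s1' he.
  have hh1 : heap_ok SC h m1 by apply: heap_ok_same s1' hh; lia.
  rewrite !size_cat /= !size_cat /=.
  case: eqP => [E|/eqP E].
  + have [||m2 [r2 v2 s2]] := IHb env rho d P pb m1 _ he1 hh1 _ hB1 hB2; [by []|lia|].
    exists m2; split=> //; last by apply: same_outside_trans s1' _; apply: same_outside_sub s2; lia.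
    apply: (@reaches_leq _ (cost B a + (cost B b).+1)); first lia.
    apply: reaches_trans r1 _; apply: (reaches_step hj) => /=; rewrite v1 E eqxx.
    by move: r2; rewrite (_ : pb + _ = pc + (size (compile SC env a d pc) + (size (compile SC env c d (pc + size (compile SC env a d pc)).+1) + (size (compile SC env b d pb)).+1).+1)) // /pb; lia.
  + have [|m2 [r2 v2 s2]] := IHc env rho d P _ m1 hcc he1 hh1 _ hB1 hB2; first lia.
    exists m2; split=> //; last by apply: same_outside_trans s1' _; apply: same_outside_sub s2; lia.
    apply: (@reaches_leq _ (cost B a + (cost B c + 1).+1)); first lia.
    apply: reaches_trans r1 _; apply: (reaches_step hj) => /=; rewrite v1 (negPf E).
    apply: reaches_trans r2 _; apply: (reaches_step hj2) => /=.
    rewrite (_ : pb + _ = pc + (size (compile SC env a d pc) + (size (compile SC env c d (pc + size (compile SC env a d pc)).+1) + (size (compile SC env b d pb)).+1).+1)) //; first exact: reaches_refl.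
    rewrite /pb; lia.
- set ca := compile SC _ a _ _ in hc *.
  have hp2 := code_at_behead (code_at_behead hc); have hp3 := code_at_behead hp2.
  have [ha hq] := code_at_cat (code_at_behead hp3).
  set H := d + (height a).+3 in hd *.
  set b := nth 0 rho v.+1.
  have bB : b <= B by rewrite /b; case: (v).
  have [h1 h2 h3 h4] := he.
  have vsz : v.+1 < size env by case: (v) => /=; lia.
  have hr := h3 _ vsz.
  (* Invariant at the loop test: [d] holds the partial sum and [d.+1] the counter; [d.+2] serves
     both the test and the summand. *)
  have loop j : j <= b -> exists mj, [/\ reaches P (j * (cost B a + 6) + 2) (pc, m) (pc.+2, mj),
      mj d = \sum_(i < j) eval (rcons rho i) h a, mj d.+1 = j & same_outside d H m mj].
    elim: j => [|j IHj] hj.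
      exists (write (write m d 0) d.+1 0); split.
      + apply: (reaches_step hc) => /=; have hp1 := code_at_behead hc.
        by apply: (reaches_step hp1) => /=; exact: reaches_refl.
      + by rewrite big_ord0 writeNE ?writeE //; lia.
      + by rewrite writeE.
      + by move=> x hx; rewrite !writeNE //; lia.
    have [|mj [r1 v1 v2 s1]] := IHj; first lia.
    set mk := write mj d.+2 (b - j).
    have sk : same_outside d H m mk.
      by apply: same_outside_trans s1 _; apply: same_outside_write; lia.
    have ek : env_ok env rho d mk by apply: env_ok_same sk he.
    have [|||||m2 [r2 w2 s2]] := IHa (rcons env d.+1) (rcons rho j) d.+2 P pc.+4 mk ha.
    + by apply: (env_ok_rcons ek); [lia|lia|]; rewrite /mk writeNE ?v2 //; lia.
    + by apply: heap_ok_same sk hh; lia.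
    + by rewrite /H in hd; lia.
    + by rewrite nth_rcons -h1 ifT //; lia.
    + by rewrite nth_rcons -h1 ifT //; lia.
    exists (write (write (write m2 d (m2 d + m2 d.+2)) d.+2 1) d.+1 j.+1); split.
    + apply: (@reaches_leq _ (j * (cost B a + 6) + 2 + (cost B a + 4).+2)); first lia.
      apply: reaches_trans r1 _.
      apply: (reaches_step hp2) => /=; rewrite (_ : mj (nth 0 env v.+1) = b); last first.
        by rewrite s1 ?h4 // hr.
      rewrite v2; apply: (reaches_step hp3) => /=; rewrite writeE ifF; last lia.
      apply: reaches_trans r2 _.
      have hq1 := code_at_behead hq; have hq2 := code_at_behead hq1; have hq3 := code_at_behead hq2.
      apply: (reaches_step hq) => /=; apply: (reaches_step hq1) => /=.
      apply: (reaches_step hq2) => /=; apply: (reaches_step hq3) => /=.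
      have E : m2 d.+1 = j by rewrite s2 /mk ?writeNE ?v2 //; lia.
      rewrite writeE (_ : write (write m2 d _) d.+2 1 d.+1 = j).
        by rewrite addn1; exact: reaches_refl.
      by rewrite !writeNE ?E //; lia.
    + have E : m2 d = mj d by rewrite s2 /mk ?writeNE //; lia.
      rewrite big_ord_recr /= -v1 -w2 -E writeNE; last lia.
      by rewrite writeNE ?writeE //; lia.
    + by rewrite writeE.
    + apply: same_outside_trans sk _; apply: same_outside_trans (_ : same_outside _ _ mk m2) _.
        by apply: same_outside_sub s2; rewrite /H; lia.
      by move=> x hx; rewrite !writeNE //; lia.
  have [mj [r1 v1 v2 s1]] := loop b (leqnn b).
  exists (write mj d.+2 0); split.
  + apply: (@reaches_leq _ (b * (cost B a + 6) + 2 + 2)).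
      by rewrite -addnA leq_add2r leq_mul2r bB orbT.
    apply: reaches_trans r1 _.
    apply: (reaches_step hp2) => /=; rewrite (_ : mj (nth 0 env v.+1) = b); last first.
      by rewrite s1 ?h4 // hr.
    rewrite v2 subnn; apply: (reaches_step hp3) => /=; rewrite writeE eqxx.
    rewrite (_ : pc + 8 + _ = pc + (size (ca ++ [:: Add d d d.+2; Const d.+2 1; Add d.+1 d.+1 d.+2; Jump pc.+2])).+4); last by rewrite size_cat /=; lia.
    exact: reaches_refl.
  + by rewrite writeNE ?v1 //; lia.
  + by apply: same_outside_trans s1 _; apply: same_outside_write; lia.
Qed.

(** Every loop is bounded by variable 2, which will hold the number of tuples. Termination and a
    polynomial cost are thereby built into the syntax. *)
Inductive cmd : Type :=
  | CStore of expr & expr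
  | CSeq of cmd & cmd
  | CFor of cmd.

Fixpoint csem (rho : seq nat) (c : cmd) (h : memory) : memory :=
  match c with
  | CStore a b => write h (eval rho h a) (eval rho h b)
  | CSeq c1 c2 => csem rho c2 (csem rho c1 h)
  | CFor c1 => iteri (nth 0 rho 2) (fun j => csem (rcons rho j) c1) h
  end.

Fixpoint ccompile (SC : nat) (env : seq nat) (c : cmd) (d pc : nat) : program :=
  match c with
  | CStore a b =>
      let ca := compile SC env a d pc in
      ca ++ compile SC env b d.+1 (pc + size ca) ++
      [:: Const d.+2 SC; Add d d d.+2; Store d d.+1]
  | CSeq c1 c2 =>
      let p1 := ccompile SC env c1 d pc in
      p1 ++ ccompile SC env c2 d (pc + size p1)
  | CFor c1 =>
      let p1 := ccompile SC (rcons env d) c1 d.+2 pc.+3 in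
      [:: Const d 0; Defs.Sub d.+1 (nth 0 env 2) d;
          JumpZero d.+1 (pc + 6 + size p1)] ++ p1 ++
      [:: Const d.+1 1; Add d d d.+1; Jump pc.+1]
  end.

Fixpoint cheight (c : cmd) : nat :=
  match c with
  | CStore a b => (maxn (height a) (height b)).+3
  | CSeq c1 c2 => maxn (cheight c1) (cheight c2)
  | CFor c1 => (cheight c1).+2
  end.

Fixpoint ccost (B : nat) (c : cmd) : nat :=
  match c with
  | CStore a b => cost B a + cost B b + 3
  | CSeq c1 c2 => ccost B c1 + ccost B c2
  | CFor c1 => B * (ccost B c1 + 5) + 3
  end.

(** Commands write into the heap, so in contrast to [same_outside] nothing is promised above their
    registers. *)
Definition same_below (d : nat) (m m' : memory) : Prop := forall a, a < d -> m' a = m a.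

Lemma env_ok_below env rho d d1 m m' :
  d <= d1 -> same_below d m m' -> env_ok env rho d m -> env_ok env rho d1 m'.
Proof.
move=> le H [h1 h2 h3 h4]; split=> // i hi; have := h3 i hi; first lia.
by move=> lt; rewrite H ?h4 ?lt.
Qed.

Lemma ccompile_correct SC c env rho B d P pc m h :
  code_at P pc (ccompile SC env c d pc) -> env_ok env rho d m -> heap_ok SC h m ->
  d + cheight c <= SC -> nth 0 rho 1 <= B -> nth 0 rho 2 <= B ->
  exists m', [/\ reaches P (ccost B c) (pc, m) (pc + size (ccompile SC env c d pc), m'),
     heap_ok SC (csem rho c h) m' & same_below d m m'].
Proof.
elim: c env rho d P pc m h => [a b|c1 IH1 c2 IH2|c IH] env rho d P pc m h /= hc he hh hd hB1 hB2.
- have [ha /code_at_cat [hb hs]] := code_at_cat hc.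
  have [|m1 [r1 v1 s1]] := compile_correct ha he hh _ hB1 hB2; first lia.
  have he1 : env_ok env rho d.+1 m1 by apply: env_ok_same s1 he.
  have hh1 : heap_ok SC h m1 by apply: heap_ok_same s1 hh; lia.
  have [|m2 [r2 v2 s2]] := compile_correct hb he1 hh1 _ hB1 hB2; first lia.
  have hh2 : heap_ok SC h m2 by apply: heap_ok_same s2 hh1; lia.
  have E1 : m2 d = eval rho h a by rewrite s2 ?v1 ?ltnSn.
  have hs1 := code_at_behead hs; have hs2 := code_at_behead hs1.
  exists (write (write (write m2 d.+2 SC) d (m2 d + SC)) (m2 d + SC) (m2 d.+1)); split.
  + rewrite -addnA; apply: reaches_trans r1 _; apply: reaches_trans r2 _.
    apply: (reaches_step hs) => /=; apply: (reaches_step hs1) => /=.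
    rewrite writeE (_ : write m2 d.+2 SC d = m2 d); last by rewrite writeNE //; lia.
    apply: (reaches_step hs2) => /=; rewrite writeE.
    rewrite !(writeNE _ _ (_ : d.+1 != _)); try lia.
    by rewrite !size_cat !addnA /= addn3; exact: reaches_refl.
  + move=> i; rewrite /= {1}/write E1 v2 [_ + SC]addnC eqn_add2l /write; case: eqP => // _.
    rewrite !ifF ?hh2 //; lia.
  + move=> x hx; do 3![rewrite writeNE; last lia].
    by rewrite s2; [rewrite s1 //; lia|lia].
- have [h1 h2] := code_at_cat hc.
  have [|m1 [r1 hh1 s1]] := IH1 _ _ _ _ _ _ _ h1 he hh _ hB1 hB2; first lia.
  have [||m2 [r2 hh2 s2]] := IH2 _ rho _ _ _ m1 _ h2 _ hh1 _ hB1 hB2.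
  + by apply: env_ok_below s1 he.
  + lia.
  exists m2; split=> //; first by rewrite size_cat addnA; apply: reaches_trans r1 r2.
  by move=> x hx; rewrite s2 ?s1.
- set ca := ccompile SC _ c _ _ in hc *.
  have hp1 := code_at_behead hc; have hp2 := code_at_behead hp1.
  have [ha hq] := code_at_cat (code_at_behead hp2).
  have [h1 h2 h3 h4] := he; have hr := h3 _ h2.
  set b := nth 0 rho 2 in hB2 *.
  have loop j : j <= b -> exists mj, [/\ reaches P (j * (ccost B c + 5) + 1) (pc, m) (pc.+1, mj),
      heap_ok SC (iteri j (fun j => csem (rcons rho j) c) h) mj, mj d = j & same_below d m mj].
    elim: j => [|j IHj] hj.
      exists (write m d 0); split.
      + by apply: (reaches_step hc) => /=; exact: reaches_refl.
      + by move=> i; rewrite writeNE ?hh //; lia.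
      + by rewrite writeE.
      + by move=> x hx; rewrite writeNE //; lia.
    have [|mj [r1 hhj v2 s1]] := IHj; first lia.
    set mk := write mj d.+1 (b - j).
    have sk : same_below d m mk.
      by move=> x hx; rewrite /mk writeNE ?s1 //; lia.
    have ek : env_ok env rho d mk by apply: env_ok_below sk he.
    have [|||||m2 [r2 w2 s2]] := IH (rcons env d) (rcons rho j) d.+2 P pc.+3 mk (iteri j (fun j => csem (rcons rho j) c) h) ha.
    + by apply: (env_ok_rcons ek); [lia|lia|]; rewrite /mk writeNE ?v2 //; lia.
    + by move=> i; rewrite /mk writeNE ?hhj //; lia.
    + lia.
    + by rewrite nth_rcons -h1 ifT //; lia.
    + by rewrite nth_rcons -h1 ifT //; lia.
    exists (write (write m2 d.+1 1) d j.+1); split.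
    + apply: (@reaches_leq _ (j * (ccost B c + 5) + 1 + (ccost B c + 3).+2)); first lia.
      apply: reaches_trans r1 _.
      apply: (reaches_step hp1) => /=; rewrite (_ : mj (nth 0 env 2) = b); last first.
        by rewrite s1 ?h4.
      rewrite v2; apply: (reaches_step hp2) => /=; rewrite writeE ifF; last lia.
      apply: reaches_trans r2 _.
      have hq1 := code_at_behead hq; have hq2 := code_at_behead hq1.
      apply: (reaches_step hq) => /=; apply: (reaches_step hq1) => /=.
      apply: (reaches_step hq2) => /=.
      have E : m2 d = j by rewrite s2 /mk ?writeNE ?v2 //; lia.
      rewrite writeE (_ : write m2 d.+1 1 d = j).
        by rewrite addn1; exact: reaches_refl.
      by rewrite !writeNE ?E //; lia.
    + by move=> i; rewrite !writeNE ?w2 //; lia.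
    + by rewrite writeE.
    + by move=> x hx; rewrite !writeNE ?s2 ?sk //; lia.
  have [mj [r1 v1 v2 s1]] := loop b (leqnn b).
  exists (write mj d.+1 0); split.
  + apply: (@reaches_leq _ (b * (ccost B c + 5) + 1 + 2)).
      by rewrite -addnA leq_add2r leq_mul2r hB2 orbT.
    apply: reaches_trans r1 _.
    apply: (reaches_step hp1) => /=; rewrite (_ : mj (nth 0 env 2) = b); last first.
      by rewrite s1 ?h4.
    rewrite v2 subnn; apply: (reaches_step hp2) => /=; rewrite writeE eqxx.
    rewrite (_ : pc + 6 + _ = pc + (size (ca ++ [:: Const d.+1 1; Add d d d.+1; Jump pc.+1])).+3); last by rewrite size_cat /=; lia.
    exact: reaches_refl.
  + by move=> i; rewrite writeNE ?v1 //; lia.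
  + by move=> x hx; rewrite writeNE ?s1 //; lia.
Qed.

Lemma reaches_nseq_add P pc q m :
  code_at P pc (nseq q (Add 0 0 1)) ->
  exists m', [/\ reaches P q (pc, m) (pc + q, m'),
    m' 0 = m 0 + q * m 1 & forall a, a != 0 -> m' a = m a].
Proof.
elim: q pc m => [|q IH] pc m hc.
  by exists m; split=> //; rewrite ?addn0 //; exact: reaches_refl.
have [m' [r E H]] := IH _ (write m 0 (m 0 + m 1)) (code_at_behead hc).
exists m'; split.
- by apply: (reaches_step hc) => /=; rewrite addnS -addSn.
- by rewrite E writeE writeNE // mulSn addnA.
- by move=> a ha; rewrite H // writeNE.
Qed.

(** Register 0 is the moving address and register 2 holds the increment 1, so that no further
    register is overwritten before it has been saved. *)
Definition save_regs (j q : nat) : program :=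
  flatten [seq [:: Add 0 0 2; Store 0 i] | i <- iota j q].

Lemma size_save_regs j q : size (save_regs j q) = q.*2.
Proof. by rewrite /save_regs; elim: q j => //= q IH j; rewrite IH. Qed.

Lemma reaches_save_regs P pc j q m :
  code_at P pc (save_regs j q) -> m 2 = 1 -> j + q <= m 0 -> 2 < j ->
  exists m', [/\ reaches P q.*2 (pc, m) (pc + q.*2, m'), m' 0 = m 0 + q,
    forall i, i < q -> m' (m 0 + i.+1) = m (j + i) &
    forall a, a != 0 -> (a <= m 0) || (m 0 + q < a) -> m' a = m a].
Proof.
rewrite /save_regs; elim: q pc j m => [|q IH] pc j m hc h2 hj hj2.
  by exists m; split=> //; rewrite ?addn0 //; exact: reaches_refl.
set m1 := write (write m 0 (m 0).+1) (m 0).+1 (m j).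
have m10 : m1 0 = (m 0).+1 by rewrite /m1 writeNE ?writeE.
have [|||m' [r E H1 H2]] := IH _ j.+1 m1 (code_at_behead (code_at_behead hc)).
- by rewrite /m1 !writeNE //; lia.
- by rewrite m10; lia.
- lia.
exists m'; split.
- apply: (reaches_step hc) => /=; apply: (reaches_step (code_at_behead hc)) => /=.
  rewrite writeE h2 addn1 (writeNE _ _ (_ : j != 0)); last lia.
  by rewrite doubleS !addnS -!addSn.
- by rewrite E m10; lia.
- case=> [|i] hi.
    by rewrite addn1 addn0 H2 ?m10 ?leqnn // /m1 writeE.
  have := H1 i; rewrite m10 addSnnS => -> //.
  by rewrite addSnnS /m1 !writeNE //; lia.
- by move=> a a0 ha; rewrite H2 ?m10 // /m1 ?writeNE //; lia.
Qed.

(** Register 0 initially holds [k]. The empty pattern is answered at once, because tuples of pattern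
    positions exist only for positive [k]. Otherwise register 4 is taken as the result of [b]. *)
Definition accept_if_zero (b : program) : program :=
  let p := 1 + size b in
  [:: JumpZero 0 (p + 3)] ++ b ++ [:: Const 0 0; Add 0 0 4; Jump (p + 4)] ++ [:: Const 0 1].

Lemma size_accept_if_zero b : size (accept_if_zero b) = 1 + size b + 4.
Proof. by rewrite /accept_if_zero /= size_cat /=; lia. Qed.

Lemma code_at_accept_if_zero b (P := accept_if_zero b) (p := 1 + size b) :
  [/\ code_at P 0 P, code_at P 1 b,
      code_at P p [:: Const 0 0; Add 0 0 4; Jump (p + 4)] &
      code_at P (p + 3) [:: Const 0 1]].
Proof.
have hc : code_at P 0 P by [].
by have /code_at_cat [_ /code_at_cat [hb /code_at_cat [h3 hl]]] := hc.
Qed.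

Lemma accept_if_zero_accepts (b : program) (w : seq nat) (P := accept_if_zero b) :
  nth 0 w 0 = 0 ->
  exists2 t, t <= 2 & let s := iter t (step P) (init_state w) in
    halted P s /\ accepting s.
Proof.
move=> w0; set p := 1 + size b.
have [hc _ _ hl] := code_at_accept_if_zero b.
have [t le E] : reaches P 2 (init_state w) (p + 4, write (nth 0 w) 0 1).
  apply: (reaches_step hc); rewrite /= w0 eqxx.
  by apply: (reaches_step hl); rewrite /= -addnS; exact: reaches_refl.
by exists t => //; rewrite E /halted /accepting size_accept_if_zero.
Qed.

(** * Relocating the input and running the compiled program *)

Section Machine.

Variables (eN : expr) (c : cmd) (r : expr).

(** Each summand is the register demand of one compiled piece, with targets 2, 4 and 4; the sum is
    merely a convenient common bound. *)
Definition scratch : nat := (2 + height eN) + (4 + cheight c) + (4 + height r).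

(* No register is free at the start.  Adding n repeatedly to R[0] = k yields an address beyond both the
   input and the scratch registers, where the registers 2 .. scratch - 1 are saved one by one; k can be
   recovered from R[0] and R[1] = n afterwards. *)
Definition prologue : program :=
  nseq scratch (Add 0 0 1) ++ [:: Store 0 2; Const 2 1] ++ save_regs 3 (scratch - 3).

(** An environment needs three entries, so register 1 stands in for variable 2 as long as [N] is
    being computed. Afterwards registers 0 to 3 are the variables of the main part. *)
Definition body : program :=
  let p1 := 1 + size prologue in
  let q1 := compile scratch [:: 0; 1; 1] eN 2 p1 in
  let p2 := p1 + size q1 + 1 in
  let q2 := ccompile scratch [:: 0; 1; 2; 3] c 4 p2 in
  let p3 := p2 + size q2 in
  prologue ++ q1 ++ [:: Const 3 scratch] ++ q2 ++
  compile scratch [:: 0; 1; 2; 3] r 4 p3.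

Definition machine : program := accept_if_zero body.

Definition machine_time (n N : nat) : nat :=
  3 * scratch + cost n eN + ccost N c + cost N r + 10.

(** Entry [i] of the input starts in register [i + 2]. If this is a scratch register, the prologue
    moves the entry to register [R + 3 + i - scratch]; otherwise it stays. The heap addresses are
    these numbers less [scratch]. *)
Lemma machine_correct (k n : nat) (data : seq nat) :
  0 < k -> k <= n -> size data = k + n ->
  let R := k + scratch * n + (scratch - 3) in
  let N := eval [:: R; n; n] (fun _ => 0) eN in
  (forall h h', eval [:: R; n; n] h eN = eval [:: R; n; n] h' eN) -> n <= N ->
  exists2 t, t <= machine_time n N &
  let s := iter t (step machine) (init_state (k :: n :: data)) in
  exists h, [/\ halted machine s,
    accepting s <-> eval [:: R; n; N; scratch] (csem [:: R; n; N; scratch] c h) r <> 0 &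
    forall i, i < k + n ->
      h (if i + 2 < scratch then R + 3 + i - scratch.*2 else i + 2 - scratch) = nth 0 data i].
Proof.
move=> k0 kn szd; set SC := scratch => R N hN nN.
have SC3 : 9 < SC by rewrite /SC /scratch; have := height_gt0 eN; lia.
pose B := k + SC * n; pose m0 := nth 0 (k :: n :: data).
have BSC : SC + k <= B by rewrite /B; nia.
have Bkn : k + n + 2 <= B by rewrite /B; nia.
have hc : code_at machine 0 machine by [].
have [hj hb hend _] := code_at_accept_if_zero body; rewrite -/machine in hj hb hend.
have hb' := hb; rewrite /body in hb'.
move: hb' => /code_at_cat [hpro /code_at_cat [hq1 /code_at_cat [hq2 /code_at_cat [hq3 hq4]]]].
move: hpro => /code_at_cat [hp1 hp2].
have [hp3 hp4] : code_at machine (1 + SC) [:: Store 0 2; Const 2 1] /\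
    code_at machine (1 + SC + 2) (save_regs 3 (SC - 3)).
  by move: hp2 => /code_at_cat []; rewrite !size_nseq.
have [m1 [r1 v1 s1]] := reaches_nseq_add m0 hp1.
have m10 : m1 0 = B by rewrite v1.
set m2 := write (write m1 B (m1 2)) 2 1.
have m20 : m2 0 = B by rewrite /m2 !writeNE //; lia.
have [|||m3 [r3 w3 x3 y3]] := reaches_save_regs (m := m2) hp4.
- by rewrite /m2 writeE.
- by rewrite m20; lia.
- by [].
have m30 : m3 0 = R by rewrite w3 m20.
have m31 : m3 1 = n.
  by rewrite y3 ?m20 //; [rewrite /m2 !writeNE ?s1 //; lia | lia].
have saved i : i + 2 < SC -> m3 (B + i) = m0 (i + 2).
  case: i => [|i] hi.
    rewrite addn0 y3 ?m20; try lia.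
    by rewrite /m2 writeNE ?writeE ?s1 //; lia.
  have := x3 i; rewrite m20 => ->; last lia.
  rewrite /m2 !writeNE; try lia.
  by rewrite s1; [congr m0; lia|lia].
have kept a : SC <= a -> a < B -> m3 a = m0 a.
  move=> h1 h2; rewrite y3 ?m20; try lia.
  by rewrite /m2 !writeNE; try lia; rewrite s1 //; lia.
pose h := fun i => m3 (SC + i).
have hh : heap_ok SC h m3 by [].
have szpro : size prologue = SC + 2 + (SC - 3).*2.
  by rewrite /prologue !size_cat size_nseq size_save_regs addnA.
have rinit : reaches machine (1 + SC + 2 + (SC - 3).*2) (init_state (k :: n :: data))
    (1 + size prologue, m3).
  rewrite szpro; apply: (@reaches_leq _ (SC + (2 + (SC - 3).*2)).+1); first lia.
  apply: (reaches_step hj) => /=; rewrite (negPf (lt0n_neq0 k0)).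
  apply: reaches_trans r1 _.
  apply: (reaches_step hp3) => /=; apply: (reaches_step (code_at_behead hp3)) => /=.
  rewrite m10 -/m2; move: r3.
  by rewrite (_ : 1 + SC + 2 + _ = 1 + (SC + 2 + (SC - 3).*2)) ?addn2 //; lia.
have e1 : env_ok [:: 0; 1; 1] [:: R; n; n] 2 m3.
  by split=> //= -[|[|[|i]]].
have [|||m4 [r4 v4 s4]] := compile_correct (B := n) hq1 e1 hh => //.
  by rewrite /SC /scratch; lia.
set p2 := (_ + 1) in hq3.
set m5 := write m4 3 SC.
have e2 : env_ok [:: 0; 1; 2; 3] [:: R; n; N; SC] 4 m5.
  split=> //=; first by case=> [|[|[|[|]]]].
  case=> [|[|[|[|i]]]] //= _; rewrite /m5 ?writeE // writeNE //; first by rewrite s4.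
    by rewrite s4.
  by rewrite v4 (hN _ (fun _ => 0)).
have hh5 : heap_ok SC h m5.
  by move=> i; rewrite /m5 writeNE ?s4 ?hh //; rewrite /SC /scratch; lia.
have [|||m6 [r6 hh6 s6]] := ccompile_correct (B := N) hq3 e2 hh5 => //.
  by rewrite /SC /scratch; lia.
have e6 : env_ok [:: 0; 1; 2; 3] [:: R; n; N; SC] 4 m6 by apply: env_ok_below s6 e2.
have [|||m7 [r7 v7 s7]] := compile_correct (B := N) hq4 e6 hh6 => //.
  by rewrite /SC /scratch; lia.
set p3 := (p2 + _) in hq4 r6 r7.
have hpf : p3 + size (compile SC [:: 0; 1; 2; 3] r 4 p3) = 1 + size body.
  have size_cat5 (l1 l2 l3 l4 l5 : program) : size (l1 ++ l2 ++ l3 ++ l4 ++ l5) =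
      size l1 + size l2 + size l3 + size l4 + size l5.
    by rewrite !size_cat !addnA.
  by rewrite /body size_cat5 /p3 /p2 !addnA.
rewrite hpf in r7.
have [t le E] : reaches machine (machine_time n N) (init_state (k :: n :: data))
   ((1 + size body) + 4, write (write m7 0 0) 0 (m7 4)).
  apply: (@reaches_leq _ (1 + SC + 2 + (SC - 3).*2 + cost n eN + 1 + ccost N c + cost N r + 3)).
    by rewrite /machine_time -/SC; lia.
  apply: reaches_trans (_ : reaches _ 3 (1 + size body, m7) _); last first.
    apply: (reaches_step hend) => /=; apply: (reaches_step (code_at_behead hend)) => /=.
    apply: (reaches_step (code_at_behead (code_at_behead hend))) => /=.
    by rewrite writeE add0n writeNE //; exact: reaches_refl.
  apply: reaches_trans r7; apply: reaches_trans r6.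
  apply: (@reaches_trans _ _ _ _ (p2.-1, m4)); last first.
    have -> : p2 = p2.-1.+1 by rewrite /p2; lia.
    have {}hq2 : code_at machine p2.-1 [:: Const 3 SC] by move: hq2; rewrite /p2 addn1.
    by apply: (reaches_step hq2); exact: reaches_refl.
  by apply: reaches_trans rinit _; move: r4; rewrite /p2 addn1.
exists t => //; rewrite E; exists h; split.
- by rewrite /halted size_accept_if_zero.
- by rewrite /accepting /= writeE v7; split=> /eqP.
- move=> i hi; rewrite /h; case: ifP => h2.
    rewrite (_ : SC + _ = B + i) ?saved /m0 ?addn2 //; rewrite /R -/B; lia.
  by rewrite (_ : SC + _ = i + 2) ?kept /m0 ?addn2 //=; lia.
Qed.
End Machine.

(** * Polynomial bounds and term builders *)

Definition poly_bounded (f : nat -> nat) : Prop :=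
  exists c d, forall n, f n <= c * n.+1 ^ d.

Lemma poly_bounded_const c : poly_bounded (fun _ => c).
Proof. by exists c, 0 => n; rewrite muln1. Qed.

Lemma poly_bounded_id : poly_bounded id.
Proof. by exists 1, 1 => n; rewrite mul1n expn1. Qed.

Lemma poly_bounded_add f g :
  poly_bounded f -> poly_bounded g -> poly_bounded (fun n => f n + g n).
Proof.
move=> [c [d H]] [c' [d' H']]; exists (c + c'), (d + d') => n.
rewrite mulnDl leq_add //.
  by apply: leq_trans (H n) _; rewrite leq_mul2l leq_pexp2l ?leq_addr ?orbT.
by apply: leq_trans (H' n) _; rewrite leq_mul2l leq_pexp2l ?leq_addl ?orbT.
Qed.

Lemma poly_bounded_mul f g :
  poly_bounded f -> poly_bounded g -> poly_bounded (fun n => f n * g n).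
Proof.
move=> [c [d H]] [c' [d' H']]; exists (c * c'), (d + d') => n.
by rewrite expnD mulnACA leq_mul.
Qed.

Lemma poly_bounded_comp f g :
  poly_bounded f -> poly_bounded g -> poly_bounded (fun n => f (g n)).
Proof.
move=> [c [d H]] [c' [d' H']]; exists (c * c'.+1 ^ d), (d' * d) => n.
apply: leq_trans (H (g n)) _; rewrite -mulnA leq_mul2l expnM -expnMn.
case: d H => [|d] H; rewrite ?expn0 ?orbT // leq_exp2r // orbC.
rewrite mulSn -addn1 addnC leq_add ?expn_gt0 //; exact: H'.
Qed.

Lemma poly_bounded_exp W : poly_bounded (fun n => n ^ W).
Proof. by exists 1, W => n; rewrite mul1n; case: W => // W; rewrite leq_exp2r. Qed.

Lemma poly_bounded_cost e : poly_bounded (fun B => cost B e).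
Proof.
elim: e => /= [_|_|a Ha b Hb|a Ha b Hb|a Ha|a Ha b Hb c Hc|_ a Ha];
  try exact: poly_bounded_const; do ?apply: poly_bounded_add;
  try exact: poly_bounded_const; try by [].
apply: poly_bounded_mul; first exact: poly_bounded_id.
by apply: poly_bounded_add => //; exact: poly_bounded_const.
Qed.

Lemma poly_bounded_ccost c : poly_bounded (fun B => ccost B c).
Proof.
elim: c => /= [a b|c1 H1 c2 H2|c Hc]; do ?apply: poly_bounded_add;
  try exact: poly_bounded_const; try exact: poly_bounded_cost; try by [].
apply: poly_bounded_mul; first exact: poly_bounded_id.
by apply: poly_bounded_add => //; exact: poly_bounded_const.
Qed.

Lemma poly_bounded_machine_time eN c r W :
  poly_bounded (fun n => machine_time eN c r n (n ^ W)).
Proof.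
have hp := poly_bounded_exp W.
by do !apply: poly_bounded_add; try exact: poly_bounded_const;
  try exact: poly_bounded_cost;
  [exact: (poly_bounded_comp (poly_bounded_ccost c) hp)
  |exact: (poly_bounded_comp (poly_bounded_cost r) hp)].
Qed.

(* Levels are absolute, so a term builder receives the level at which it is placed;
   a value [v] is denoted if it is obtained in every extension of the environment. *)
Definition gexp : Type := nat -> expr.

Definition gvar (i : nat) : gexp := fun _ => EVar i.
Definition gcst (c : nat) : gexp := fun _ => ECst c.
Definition gadd (a b : gexp) : gexp := fun l => EAdd (a l) (b l).
Definition gsub (a b : gexp) : gexp := fun l => ESub (a l) (b l).
Definition gload (a : gexp) : gexp := fun l => ELoad (a l).
Definition gifz (a b c : gexp) : gexp := fun l => EIfz (a l) (b l) (c l).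
Definition gsum (v : bool) (f : gexp -> gexp) : gexp :=
  fun l => ESum v (f (gvar l) l.+1).

Definition den (h : memory) (rho : seq nat) (g : gexp) (v : nat) : Prop :=
  forall s, eval (rho ++ s) h (g (size (rho ++ s))) = v.

(* A formula is a term that is zero when the formula holds. *)
Definition tru (h : memory) (rho : seq nat) (g : gexp) (P : bool) : Prop :=
  forall s, (eval (rho ++ s) h (g (size (rho ++ s))) == 0) = P.

(** With zero as truth, addition is conjunction and [gsum] is a universal quantifier; truncated
    subtraction supplies negation and comparison. *)
Definition gnot (a : gexp) := gsub (gcst 1) a.
Definition gimp (a b : gexp) := gsub (gcst 1) (gadd a (gnot b)).
Definition glt (a b : gexp) := gsub (gadd a (gcst 1)) b.
Definition geq (a b : gexp) := gadd (gsub a b) (gsub b a).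
Definition gex (v : bool) (f : gexp -> gexp) := gnot (gsum v (fun x => gnot (f x))).
Definition gall (l : seq gexp) : gexp := foldr gadd (gcst 0) l.

Section Denotation.

Variable h : memory.
Implicit Types (rho : seq nat) (a b c g : gexp) (P Q : bool).

Lemma den_ext rho s a v : den h rho a v -> den h (rho ++ s) a v.
Proof. by move=> H s'; rewrite -catA. Qed.

Lemma den_eval rho a v : den h rho a v -> eval rho h (a (size rho)) = v.
Proof. by move/(_ [::]); rewrite cats0. Qed.

Lemma tru_eval rho a P : tru h rho a P -> (eval rho h (a (size rho)) == 0) = P.
Proof. by move/(_ [::]); rewrite cats0. Qed.

Lemma den_var rho i : i < size rho -> den h rho (gvar i) (nth 0 rho i).
Proof. by move=> hi s /=; rewrite nth_cat hi. Qed.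

Lemma den_cst rho (x : nat) : den h rho (gcst x) x.
Proof. by []. Qed.

Lemma den_add rho a b x y :
  den h rho a x -> den h rho b y -> den h rho (gadd a b) (x + y).
Proof. by move=> ha hb s /=; rewrite ha hb. Qed.

Lemma den_sub rho a b x y :
  den h rho a x -> den h rho b y -> den h rho (gsub a b) (x - y).
Proof. by move=> ha hb s /=; rewrite ha hb. Qed.

Lemma den_load rho a x : den h rho a x -> den h rho (gload a) (h x).
Proof. by move=> ha s /=; rewrite ha. Qed.

Lemma den_ifz rho a b c x y z :
  den h rho a x -> den h rho b y -> den h rho c z ->
  den h rho (gifz a b c) (if x == 0 then y else z).
Proof. by move=> ha hb hc s /=; rewrite ha hb hc. Qed.

Lemma den_sum rho (v : bool) f F : 2 < size rho ->
  (forall s x j, j < nth 0 rho v.+1 -> den h (rho ++ s) x j ->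
     den h (rho ++ s) (f x) (F j)) ->
  den h rho (gsum v f) (\sum_(j < nth 0 rho v.+1) F j).
Proof.
move=> sz H s /=.
have -> : nth 0 (rho ++ s) v.+1 = nth 0 rho v.+1 by rewrite nth_cat ifT //; case: (v); lia.
apply: eq_bigr => j _; rewrite -(size_rcons (rho ++ s) j) rcons_cat.
apply/den_eval/H => // s'; rewrite /= -rcons_cat nth_cat size_rcons ltnSn.
by rewrite nth_rcons ltnn eqxx.
Qed.

(** The second conjunct needs a meaning only if the first holds: a range test thus protects the
    table lookups after it. *)
Lemma tru_and rho a b P Q :
  tru h rho a P -> (P -> tru h rho b Q) -> tru h rho (gadd a b) (P && Q).
Proof.
move=> ha hb s /=; rewrite addn_eq0 ha.
by case: P hb {ha} => //= hb; rewrite hb.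
Qed.

Lemma tru_not rho a P : tru h rho a P -> tru h rho (gnot a) (~~ P).
Proof. by move=> ha s /=; rewrite -(ha s); case: (eval _ _ _). Qed.

Lemma tru_imp rho a b P Q :
  tru h rho a P -> (P -> tru h rho b Q) -> tru h rho (gimp a b) (P ==> Q).
Proof.
move=> ha hb s /=; have := ha s; case: (eval _ _ (a _)) => [|u] /= E; subst P.
  by rewrite -(hb isT s) add0n; case: (eval _ _ _).
by rewrite addSn.
Qed.

Lemma tru_le rho a b x y :
  den h rho a x -> den h rho b y -> tru h rho (gsub a b) (x <= y).
Proof. by move=> ha hb s /=; rewrite ha hb. Qed.

Lemma tru_lt rho a b x y :
  den h rho a x -> den h rho b y -> tru h rho (glt a b) (x < y).
Proof. by move=> ha hb s /=; rewrite ha hb addn1. Qed.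

Lemma tru_eq rho a b x y :
  den h rho a x -> den h rho b y -> tru h rho (geq a b) (x == y).
Proof. by move=> ha hb s /=; rewrite ha hb addn_eq0 [RHS]eqn_leq. Qed.

Lemma tru_forall rho (v : bool) f (F : nat -> bool) : 2 < size rho ->
  (forall s x j, j < nth 0 rho v.+1 -> den h (rho ++ s) x j ->
     tru h (rho ++ s) (f x) (F j)) ->
  tru h rho (gsum v f) [forall j : 'I_(nth 0 rho v.+1), F j].
Proof.
move=> sz H s /=.
have -> : nth 0 (rho ++ s) v.+1 = nth 0 rho v.+1 by rewrite nth_cat ifT //; case: (v); lia.
rewrite sum_nat_eq0; apply: eq_forallb => j; rewrite /= -(size_rcons (rho ++ s) j) rcons_cat.
apply/tru_eval/H => // s'; rewrite /= -rcons_cat nth_cat size_rcons ltnSn.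
by rewrite nth_rcons ltnn eqxx.
Qed.

Lemma tru_exists rho (v : bool) f (F : nat -> bool) : 2 < size rho ->
  (forall s x j, j < nth 0 rho v.+1 -> den h (rho ++ s) x j ->
     tru h (rho ++ s) (f x) (F j)) ->
  tru h rho (gex v f) [exists j : 'I_(nth 0 rho v.+1), F j].
Proof.
move=> sz H; rewrite -[[exists _, _]]negbK negb_exists.
apply: tru_not; apply: (tru_forall (F := fun j => ~~ F j)) => // s x j hj hx.
exact/tru_not/H.
Qed.

Lemma tru_all rho (I : eqType) (l : seq I) (F : I -> gexp) (P : I -> bool) :
  (forall i, i \in l -> tru h rho (F i) (P i)) ->
  tru h rho (gall [seq F i | i <- l]) (all P l).
Proof.
elim: l => //= i l IH H; apply: tru_and => [|_]; first by apply: H; rewrite inE eqxx.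
by apply: IH => j hj; apply: H; rewrite inE hj orbT.
Qed.

End Denotation.

(** * Consistency by elimination *)

Section Elimination.

Variables (N : nat) (upd : (nat -> bool) -> nat -> bool).

Definition below (al al' : nat -> bool) : Prop := forall x, x < N -> al x -> al' x.

Hypothesis upd_mono : forall al al' x, below al al' -> upd al x -> upd al' x.

Definition kill (x : nat) (al : nat -> bool) : nat -> bool :=
  fun y => al y && ((y == x) ==> upd al x).

Definition sweep (al : nat -> bool) : nat -> bool := iteri N kill al.

Definition eliminate (al : nat -> bool) : nat -> bool := iteri N (fun _ => sweep) al.

Lemma kill_below x al : below (kill x al) al.
Proof. by move=> y _ /andP []. Qed.

Lemma iteri_kill_below i j al :
  i <= j -> below (iteri j kill al) (iteri i kill al).
Proof.
move=> /subnK <-; elim: (j - i) => [|d IH] y hy //= h.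
exact/IH/(kill_below hy h).
Qed.

Lemma sweep_below al : below (sweep al) al.
Proof. exact: (@iteri_kill_below 0). Qed.

(** When [x] was tested, the family was contained in [al], hence in the final one, and monotonicity
    transfers the test. *)
Lemma sweep_stable_closed al :
  below al (sweep al) -> forall x, x < N -> al x -> upd (sweep al) x.
Proof.
move=> H x hx /(H x hx) hs.
have /andP [_] := @iteri_kill_below x.+1 N al hx x hx hs.
rewrite eqxx /=; apply: upd_mono => y hy h.
exact/H/(@iteri_kill_below 0 x).
Qed.

Lemma sweep_closed_below (S : nat -> bool) al :
  (forall x, x < N -> S x -> upd S x) -> below S al -> below S (sweep al).
Proof.
move=> cl H; rewrite /sweep.
elim: {1}N => [|i IH] //= x hx Sx; rewrite /kill IH //=.
apply/implyP => /eqP E; subst i; apply: upd_mono IH _; exact: cl.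
Qed.

Lemma eliminate_below al : below (eliminate al) al.
Proof.
rewrite /eliminate; elim: {1}N => [|i IH] x hx //= /(sweep_below hx); exact: IH.
Qed.

Lemma eliminate_closed_below (S : nat -> bool) al :
  (forall x, x < N -> S x -> upd S x) -> below S al -> below S (eliminate al).
Proof.
move=> cl H; rewrite /eliminate.
by elim: {1}N => [|i IH] //=; apply: sweep_closed_below.
Qed.

(** A sweep that removes nothing proves closedness, which later sweeps preserve; any other sweep
    lowers the number of survivors, at most [N] at the start. After [N] sweeps the family is closed
    or empty. *)
Lemma eliminate_closed al x : x < N -> eliminate al x -> upd (eliminate al) x.
Proof.
pose it r := iteri r (fun _ => sweep) al.
pose cl (a : nat -> bool) := forall x, x < N -> a x -> upd a x.
pose cnt (a : nat -> bool) := #|[set y : 'I_N | a y]|.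
suff : cl (it N) by apply.
have H r : cl (it r) \/ cnt (it r) + r <= N.
  elim: r => [|r [IH|IH]] /=.
  - by right; rewrite addn0 -[X in _ <= X]card_ord max_card.
  - left => y hy /(sweep_below hy) h; apply: upd_mono (IH y hy h).
    exact: sweep_closed_below.
  - have sub : [set y : 'I_N | sweep (it r) y] \subset [set y : 'I_N | it r y].
      by apply/subsetP => y; rewrite !inE; apply: sweep_below.
    case: (boolP ([set y : 'I_N | it r y] \subset [set y : 'I_N | sweep (it r) y])) => sub2.
      left => y hy /(sweep_below hy); apply: sweep_stable_closed => // z hz.
      by move: sub2 => /subsetP /(_ (Ordinal hz)); rewrite !inE.
    right; apply: leq_trans IH; rewrite addnS ltn_add2r.
    by apply: proper_card; rewrite /proper sub.
case: (H N) => // le y hy hs.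
have : 0 < cnt (it N) by apply/card_gt0P; exists (Ordinal hy); rewrite inE.
lia.
Qed.

End Elimination.

(** Digits in base [n], least significant first. A number below [n ^ w.*2] codes [w] pairs: even
    digits are pattern positions, odd digits text positions. *)
Fixpoint dig (n j x : nat) : nat :=
  if j is j'.+1 then dig n j' (x %/ n) else x %% n.

Lemma dig_lt n j x : 0 < n -> dig n j x < n.
Proof. by move=> n0; elim: j x => //= x; rewrite ltn_mod. Qed.

Lemma dig_surj n D (f : nat -> nat) : 0 < n -> (forall j, f j < n) ->
  exists2 x, x < n ^ D & forall j, j < D -> dig n j x = f j.
Proof.
move=> n0; elim: D f => [|D IH] f hf; first by exists 0.
have [x hx E] := IH (fun j => f j.+1) (fun j => hf j.+1).
exists (f 0 + x * n).
  rewrite expnS; have := hf 0; nia.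
case=> [|j] hj /=; first by rewrite addnC modnMDl modn_small.
by rewrite addnC divnMDl // divn_small // addn0 E.
Qed.

Definition gmul_n (a : gexp) : gexp := gsum false (fun _ => a).

(** Division by counting: the quotient is the number of [t] with [n * t.+1 <= a]. The range [t < N]
    is long enough as long as [a] is below [N]. *)
Definition gdivn (a : gexp) : gexp :=
  gsum true (fun t => gnot (gsub (gmul_n (gadd t (gcst 1))) a)).

Fixpoint gdig (j : nat) (a : gexp) : gexp :=
  if j is j'.+1 then gdig j' (gdivn a) else gsub a (gmul_n (gdivn a)).

Lemma sum_ltn_leq (q M : nat) : q <= M -> \sum_(t < M) (t < q) = q.
Proof.
suff -> : \sum_(t < M) (t < q) = minn q M by move/minn_idPl.
elim: M => [|M IH]; first by rewrite big_ord0 minn0.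
by rewrite big_ord_recr /= IH; case: ltnP; lia.
Qed.

(** * The consistency program and its meaning *)

Section Program.

(* Levels 0-3 hold, in this order: the last register of the saved input, n, N = n ^ (2 w)
   and the base of the heap. *)
Variable w : nat.

Definition gR := gvar 0.
Definition gSC := gvar 3.
Definition gk := gsub (gsub gR (gmul_n gSC)) (gsub gSC (gcst 3)).

Definition gentry (i : gexp) : gexp :=
  gload (gifz (gsub (gadd i (gcst 3)) gSC)
    (gsub (gadd (gadd gR (gcst 3)) i) (gadd gSC gSC))
    (gsub (gadd i (gcst 2)) gSC)).

Definition gpat (a : gexp) : gexp := gentry a.
Definition gtxt (b : gexp) : gexp := gentry (gadd gk b).
(** Cell [x] of the table is register [R + 1 + x], just beyond the saved input, expressed as a heap
    address. *)
Definition gcell (x : gexp) : gexp := gadd (gsub (gadd gR (gcst 1)) gSC) x.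
Definition ga (i : nat) (x : gexp) : gexp := gdig i.*2 x.
Definition gb (i : nat) (x : gexp) : gexp := gdig i.*2.+1 x.

(** Applied to both orders of a pair, the weak inequality of positions forces equal pattern
    positions to have equal images, and the strict inequality of values forces distinct ones to have
    distinct images. *)
Definition gcompat (x : gexp) (ij : nat * nat) : gexp :=
  let: (i, j) := ij in
  gadd (gimp (gsub (ga i x) (ga j x)) (gsub (gb i x) (gb j x)))
    (gimp (glt (gpat (ga i x)) (gpat (ga j x))) (glt (gtxt (gb i x)) (gtxt (gb j x)))).

Definition pairs : seq (nat * nat) := [seq (i, j) | i <- iota 0 w, j <- iota 0 w].

Definition glocal (x : gexp) : gexp :=
  gadd (gall [seq glt (ga i x) gk | i <- iota 0 w]) (gall [seq gcompat x ij | ij <- pairs]).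

(** The constant is 0, and so the premise true, exactly when [j] differs from [i]. *)
Definition gsame (i : nat) (x y : gexp) : gexp :=
  gall [seq gimp (gcst (j == i)) (gadd (geq (ga j x) (ga j y)) (geq (gb j x) (gb j y)))
       | j <- iota 0 w].

(** The forth condition of the pebble game: pebble [i] may be lifted and put on any pattern position
    [v], and some surviving tuple must answer this move. *)
Definition gupd (x : gexp) : gexp :=
  gall [seq gsum false (fun v => gimp (glt v gk)
          (gex true (fun y => gadd (gload (gcell y)) (gadd (geq (ga i y) v) (gsame i y x)))))
       | i <- iota 0 w].

Definition ppm_N : expr := iter w.*2 (ESum false) (ECst 1).

(** A cell is zero while its tuple is alive. Adding the outcome of the test to the old content keeps
    dead tuples dead. *)
Definition ppm_cmd : cmd :=
  CSeq (CFor (CStore (gcell (gvar 4) 5) (glocal (gvar 4) 5)))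
    (CFor (CFor (CStore (gcell (gvar 5) 6)
       (gadd (gload (gcell (gvar 5))) (gupd (gvar 5)) 6)))).

Definition ppm_result : expr :=
  gsum true (fun x => gnot (gload (gcell x))) 4.

Lemma eval_ppm_N R n h : eval [:: R; n; n] h ppm_N = n ^ w.*2.
Proof.
suff H s : eval ([:: R; n; n] ++ s) h ppm_N = n ^ w.*2 by have := H [::].
rewrite /ppm_N; elim: w.*2 s => //= D IH s.
rewrite (eq_bigr (fun _ => n ^ D)); last first.
  by move=> j _; rewrite -(IH (rcons s j)).
by rewrite sum_nat_const card_ord expnS.
Qed.

Section Semantics.

Variables (k n SC : nat) (data : seq nat).
Hypotheses (k_gt0 : 0 < k) (le_kn : k <= n) (SC_gt : 9 < SC).

Let N := n ^ w.*2.
Let R := k + SC * n + (SC - 3).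
Let G := [:: R; n; N; SC].

Definition entries_ok (h : memory) : Prop := forall i, i < k + n ->
  h (if i + 2 < SC then R + 3 + i - SC.*2 else i + 2 - SC) = nth 0 data i.

Let pat i := nth 0 data i.
Let txt i := nth 0 data (k + i).
Definition tup_a i x := dig n i.*2 x.
Definition tup_b i x := dig n i.*2.+1 x.

Definition compat x (ij : nat * nat) : bool :=
  let: (i, j) := ij in
  ((tup_a i x <= tup_a j x) ==> (tup_b i x <= tup_b j x)) &&
  ((pat (tup_a i x) < pat (tup_a j x)) ==> (txt (tup_b i x) < txt (tup_b j x))).

Definition local x : bool :=
  all (fun i => tup_a i x < k) (iota 0 w) && all (compat x) pairs.

Definition same_but i x y : bool :=
  all (fun j => (j != i) ==> (tup_a j x == tup_a j y) && (tup_b j x == tup_b j y)) (iota 0 w).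

Definition forth (al : nat -> bool) x : bool :=
  all (fun i => [forall v : 'I_n, (v < k) ==>
    [exists y : 'I_N, [&& al y, tup_a i y == v & same_but i y x]]]) (iota 0 w).

Lemma forth_mono al al' x : below N al al' -> forth al x -> forth al' x.
Proof.
move=> H /allP hf; apply/allP => i /hf /forallP hv; apply/forallP => v.
apply/implyP => /(implyP (hv v)) /existsP [y /and3P [h1 h2 h3]].
by apply/existsP; exists y; rewrite h2 h3 H.
Qed.

Let n_gt0 : 0 < n.
Proof. lia. Qed.

Variable h : memory.

Let den' s g v := den h (G ++ s) g v.

Lemma den_gmul_n s a x : den' s a x -> den' s (gmul_n a) (n * x).
Proof.
move=> ha; have -> : n * x = \sum_(j < nth 0 (G ++ s) false.+1) x.
  by rewrite sum_nat_const card_ord.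
by apply: den_sum => // s' y j _ _; apply: den_ext.
Qed.

Lemma den_gR s : den' s gR R.
Proof. exact: (@den_var h (G ++ s) 0). Qed.

Lemma den_gSC s : den' s gSC SC.
Proof. exact: (@den_var h (G ++ s) 3). Qed.

Lemma den_gk s : den' s gk k.
Proof.
have -> : k = R - n * SC - (SC - 3) by rewrite /R; lia.
apply: den_sub; last by apply: den_sub => //; exact: den_gSC.
by apply: den_sub; [exact: den_gR | apply: den_gmul_n; exact: den_gSC].
Qed.

Lemma den_gdivn s a x : x < N -> den' s a x -> den' s (gdivn a) (x %/ n).
Proof.
move=> hx ha.
have -> : x %/ n = \sum_(j < nth 0 (G ++ s) true.+1) (1 - (n * (j + 1) - x)).
  rewrite /= -[LHS](@sum_ltn_leq _ N); last by apply: leq_trans (leq_div x n) (ltnW hx).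
  apply: eq_bigr => t _; rewrite leq_divRL // addn1 mulnC.
  rewrite -subn_eq0; by case: (n * t.+1 - x).
apply: (@den_sum _ _ true _ (fun j => 1 - (n * (j + 1) - x))) => // s' y j _ hy.
apply: den_sub; first exact: den_cst.
apply: den_sub; last exact: den_ext.
rewrite -catA in hy *; apply: den_gmul_n; apply: den_add => //.
Qed.

Lemma den_gdig s j a x : x < N -> den' s a x -> den' s (gdig j a) (dig n j x).
Proof.
elim: j a x => [|j IH] a x hx ha /=.
  have -> : x %% n = x - n * (x %/ n) by rewrite {2}(divn_eq x n); lia.
  by apply: den_sub => //; apply: den_gmul_n; apply: den_gdivn.
apply: IH; last exact: den_gdivn.
exact: leq_ltn_trans (leq_div x n) hx.
Qed.

Lemma den_gentry s a i : entries_ok h -> i < k + n ->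
  den' s a i -> den' s (gentry a) (nth 0 data i).
Proof.
move=> hok hi ha; rewrite -(hok i hi).
have -> : (if i + 2 < SC then R + 3 + i - SC.*2 else i + 2 - SC) =
  (if i + 3 - SC == 0 then R + 3 + i - (SC + SC) else i + 2 - SC).
  by rewrite -addnn subn_eq0 !addnS.
have hR := den_gR s; have hSC := den_gSC s.
apply: den_load; apply: den_ifz.
- by apply: den_sub => //; apply: den_add => //; exact: den_cst.
- apply: den_sub; last exact: den_add.
  by apply: den_add => //; apply: den_add => //; exact: den_cst.
- by apply: den_sub => //; apply: den_add => //; exact: den_cst.
Qed.

Lemma tru_glocal s a x : entries_ok h -> x < N -> den' s a x ->
  tru h (G ++ s) (glocal a) (local x).
Proof.
move=> hok hx ha; apply: tru_and.
  apply: tru_all => i _; apply: tru_lt; [exact: den_gdig | exact: den_gk].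
move=> /allP hk; apply: tru_all => -[i j] /allpairsP [[i' j'] /= [hi hj [-> ->]]].
have da q : den' s (ga q a) (tup_a q x) by apply: den_gdig.
have db q : den' s (gb q a) (tup_b q x) by apply: den_gdig.
have bn q : tup_b q x < n by apply: dig_lt.
apply: tru_and => [|_].
  apply: tru_imp => [|_]; first exact: tru_le (da _) (da _).
  exact: tru_le (db _) (db _).
have dt q : den' s (gadd gk (gb q a)) (k + tup_b q x).
  by apply: den_add; [exact: den_gk | exact: db].
apply: tru_imp => [|_]; apply: tru_lt.
- by apply: den_gentry (da _) => //; have := hk _ hi; lia.
- by apply: den_gentry (da _) => //; have := hk _ hj; lia.
- by apply: den_gentry (dt _) => //; rewrite ltn_add2l.
- by apply: den_gentry (dt _) => //; rewrite ltn_add2l.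
Qed.

Definition cell x := R + 1 - SC + x.

Lemma den_gcell s a x : den' s a x -> den' s (gcell a) (cell x).
Proof.
move=> ha; apply: den_add ha.
exact: den_sub (den_add (den_gR s) (den_cst _ _ 1)) (den_gSC s).
Qed.

Definition alive x : bool := h (cell x) == 0.

Lemma tru_gsame s i a b x y : x < N -> y < N -> den' s a x -> den' s b y ->
  tru h (G ++ s) (gsame i a b) (same_but i x y).
Proof.
move=> hx hy ha hb; apply: tru_all => j _; apply: tru_imp => [s'|_] /=.
  by case: (j == i).
by apply: tru_and => [|_]; apply: tru_eq; apply: den_gdig.
Qed.

Lemma tru_gupd s a x : x < N -> den' s a x ->
  tru h (G ++ s) (gupd a) (forth alive x).
Proof.
move=> hx ha; apply: tru_all => i _.
apply: (@tru_forall _ _ false _ (fun v => (v < k) ==>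
  [exists y : 'I_N, [&& alive y, tup_a i y == v & same_but i y x]])) => // s1 gv v _ hv.
rewrite -catA in hv *; apply: tru_imp => [|_].
  by apply: tru_lt => //; exact: den_gk.
apply: (@tru_exists _ _ true _ (fun y => [&& alive y, tup_a i y == v & same_but i y x])) => //.
move=> s2 gy y hy dy; rewrite -catA in dy *.
apply: tru_and => [s3|_]; first by rewrite (den_load (den_gcell dy)).
apply: tru_and => [|_].
  by apply: tru_eq; [exact: den_gdig | rewrite catA; exact: den_ext].
by apply: tru_gsame => //; rewrite /den' !catA; do 2!apply: den_ext.
Qed.

End Semantics.

Section Run.

Variables (k n SC : nat) (data : seq nat).
Hypotheses (k_gt0 : 0 < k) (le_kn : k <= n) (SC_gt : 9 < SC).

Let N := n ^ w.*2.
Let R := k + SC * n + (SC - 3).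
Let G := [:: R; n; N; SC].

Let cl := cell k n SC.
Let av := alive k n SC.
Let eok := entries_ok k n SC data.
Let lc := local k n data.
Let fo := forth k n.

Lemma csem_store rho a b h :
  csem rho (CStore a b) h = write h (eval rho h a) (eval rho h b).
Proof. by []. Qed.

Lemma alive_write h x v y :
  av (write h (cl x) v) y = if y == x then v == 0 else av h y.
Proof. by rewrite /av /alive /cl /cell /write eqn_add2l; case: (y == x). Qed.

Lemma entries_ok_write h x v : eok h -> eok (write h (cl x) v).
Proof.
move=> hok i hi; rewrite writeNE ?hok // /cl /cell.
have : k + n <= k + SC * n by rewrite leq_add2l leq_pmull //; lia.
by case: ifP; lia.
Qed.

Lemma csem_init h : eok h ->
  let h1 := csem G (CFor (CStore (gcell (gvar 4) 5) (glocal (gvar 4) 5))) h in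
  eok h1 /\ forall x, x < N -> av h1 x = lc x.
Proof.
move=> hok; set c := CStore _ _.
pose it i := iteri i (fun j => csem (rcons G j) c) h.
suff H i : i <= N -> eok (it i) /\ forall x, x < i -> av (it i) x = lc x.
  exact: (H N (leqnn N)).
elim: i => [|i IH] hi; first by [].
have [{}hok Hal] := IH (ltnW hi).
rewrite {1 2}/it iteriS -/(it i) csem_store; set h1 := it i in hok Hal *.
have dx : den h1 (G ++ [:: i]) (gvar 4) i by exact: (@den_var h1 (G ++ [:: i]) 4).
rewrite (den_eval (den_gcell dx) : eval (rcons G i) h1 (gcell (gvar 4) 5) = cl i).
split; first exact: entries_ok_write.
move=> x hx; rewrite alive_write; case: eqP => [->|/eqP ne].
  exact: (tru_eval (tru_glocal k_gt0 le_kn SC_gt hok hi dx)).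
by apply: Hal; lia.
Qed.

Lemma csem_eliminate h (al : nat -> bool) : eok h -> (forall x, x < N -> av h x = al x) ->
  let h1 := csem G (CFor (CFor (CStore (gcell (gvar 5) 6)
       (gadd (gload (gcell (gvar 5))) (gupd (gvar 5)) 6)))) h in
  forall x, x < N -> av h1 x = eliminate N fo al x.
Proof.
move=> hok hal; set c := CStore _ _.
pose it i := iteri i (fun r => csem (rcons G r) (CFor c)) h.
suff H i : eok (it i) /\ forall x, x < N -> av (it i) x = iteri i (fun _ => sweep N fo) al x.
  exact: (H N).2.
elim: i => [|r [{}hok {}Hal]] //.
rewrite {1 2}/it !iteriS -/(it r); set h1 := it r in hok Hal *.
set al1 := iteri r _ al in Hal *; rewrite /sweep.
pose it2 i := iteri i (fun j => csem (rcons (rcons G r) j) c) h1.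
suff H i : i <= N -> eok (it2 i) /\ forall x, x < N -> av (it2 i) x = iteri i (kill fo) al1 x.
  exact: (H N).
elim: i => [|i IH] hi; first by [].
have [{}hok {}Hal] := IH (ltnW hi).
rewrite {1 2}/it2 !iteriS -/(it2 i) csem_store; set h2 := it2 i in hok Hal *.
set al2 := iteri i _ al1 in Hal *.
have dx : den h2 (G ++ [:: r; i]) (gvar 5) i by exact: (@den_var h2 (G ++ [:: r; i]) 5).
rewrite (den_eval (den_gcell dx) : eval (rcons (rcons G r) i) h2 (gcell (gvar 5) 6) = cl i).
split; first exact: entries_ok_write.
move=> x hx; rewrite alive_write /kill; case: eqP => [->|_]; last by rewrite Hal ?andbT.
rewrite implyTb -(Hal _ hi).
transitivity (av h2 i && fo (av h2) i).
  apply: (tru_eval (_ : tru h2 (G ++ [:: r; i]) (gadd (gload (gcell (gvar 5))) (gupd (gvar 5))) _)).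
  apply: tru_and => [s|_]; first by rewrite (den_load (den_gcell dx)).
  exact: tru_gupd.
congr (_ && _).
(* Table and family agree only below [N], and [forth] looks no further; monotonicity in both
   directions turns this into equality. *)
by apply/idP/idP; apply: forth_mono => y hy; rewrite Hal.
Qed.

Lemma run_ppm h : eok h ->
  eval G (csem G ppm_cmd h) ppm_result <> 0 <->
  exists2 x, x < N & eliminate N fo lc x.
Proof.
move=> hok; have [hok1 Hal1] := csem_init hok; have Hal := csem_eliminate hok1 Hal1.
rewrite -/(csem G ppm_cmd h) in Hal *; set h2 := csem G ppm_cmd h in Hal *.
have E : (eval G h2 ppm_result == 0) = [forall x : 'I_N, ~~ av h2 x].
  apply: (tru_eval (rho := G) (a := gsum true (fun x => gnot (gload (gcell x))))).
  apply: (@tru_forall _ G true _ (fun x => ~~ av h2 x)) => // s gx x hx dx.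
  by apply: tru_not => s'; rewrite (den_load (den_gcell dx)).
split=> [/eqP|[x hx hs]].
  rewrite E => /forallPn [x]; rewrite negbK Hal // => hx; by exists x.
apply/eqP; rewrite E; apply/forallPn; exists (Ordinal hx); by rewrite negbK Hal.
Qed.

End Run.
End Program.

Definition code (k n : nat) (pi : 'S_k) (tau : 'S_n) : seq nat :=
  [seq nat_of_ord (pi i) | i : 'I_k] ++ [seq nat_of_ord (tau i) | i : 'I_n].

Lemma size_code k n (pi : 'S_k) (tau : 'S_n) : size (code pi tau) = k + n.
Proof. by rewrite size_cat !size_image !card_ord. Qed.

Lemma nth_image_ord k (pi : 'S_k) (i : 'I_k) :
  nth 0 [seq nat_of_ord (pi i) | i : 'I_k] i = pi i.
Proof. by rewrite (nth_map i) ?size_enum_ord // nth_ord_enum. Qed.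

Lemma nth_code_pattern k n (pi : 'S_k) (tau : 'S_n) (i : 'I_k) :
  nth 0 (code pi tau) i = pi i.
Proof. by rewrite nth_cat size_image card_ord ltn_ord nth_image_ord. Qed.

Lemma nth_code_text k n (pi : 'S_k) (tau : 'S_n) (i : 'I_n) :
  nth 0 (code pi tau) (k + i) = tau i.
Proof.
by rewrite nth_cat size_image card_ord ltnNge leq_addr addKn nth_image_ord.
Qed.

Definition survives (w k n : nat) (data : seq nat) : nat -> bool :=
  eliminate (n ^ w.*2) (forth w k n) (local w k n data).

Lemma contains_empty n (tau : 'S_n) (pi : 'S_0) : contains tau pi.
Proof. by exists (fun i : 'I_0 => match i with Ordinal m h => False_rect _ (notF h) end); split=> -[]. Qed.

Lemma polynomial_time_of_consistency (C : perm_set) (w : nat) : 0 < w ->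
  (forall k n (pi : 'S_k) (tau : 'S_n), 0 < k -> k <= n -> C k pi ->
    (exists2 x, x < n ^ w.*2 & survives w k n (code pi tau) x) <-> contains tau pi) ->
  polynomial_time (pattern_PPM C).
Proof.
move=> w0 H; pose r := ppm_result; pose c := ppm_cmd w; pose eN := ppm_N w.
have [cc [d Hcd]] := poly_bounded_machine_time eN c r w.*2.
(* The summand 2 pays for the empty pattern, accepted within two steps. *)
exists (machine eN c r), (cc + 2), d => -[k n pi tau hC hkn] /=.
rewrite /decides_within /= -/(code pi tau).
case: (posnP k) => [k0|k0].
  subst k; have [t le [h1 h2]] := @accept_if_zero_accepts (body eN c r) (ppm_code (PPMInstance tau hC hkn)) erefl.
  exists t; last by split=> //; split=> // _; exact: contains_empty.
  by apply: leq_trans le _; rewrite -[X in X <= _]muln1 leq_mul ?expn_gt0 ?leq_addl.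
have nN : n <= n ^ w.*2.
  rewrite -{1}(expn1 n) leq_pexp2l //; lia.
have [||t le [h [h1 h2 h3]]] := @machine_correct eN c r k n (code pi tau) k0 hkn (size_code _ _).
- by move=> h h'; rewrite !eval_ppm_N.
- by rewrite eval_ppm_N.
rewrite eval_ppm_N in le h2.
exists t.
  apply: leq_trans le (leq_trans (Hcd n) _); rewrite leq_mul2r leq_addr orbT //.
split=> //; rewrite h2 -(H _ _ _ _ k0 hkn hC).
apply: run_ppm => //; rewrite /scratch; have := height_gt0 eN; lia.
Qed.

(** * Embeddings survive the elimination *)

Section Soundness.

Variables (w k n : nat) (pi : 'S_k) (tau : 'S_n).
Hypotheses (k_gt0 : 0 < k) (le_kn : k <= n).

Let N := n ^ w.*2.
Let data := code pi tau.

Let n_gt0 : 0 < n.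
Proof. lia. Qed.

Lemma tuple_surj (a b : nat -> nat) :
  (forall i, a i < n) -> (forall i, b i < n) ->
  exists2 x, x < N & forall i, i < w -> tup_a n i x = a i /\ tup_b n i x = b i.
Proof.
move=> ha hb.
have [||x hx E] := @dig_surj n w.*2 (fun j => if odd j then b j./2 else a j./2) => //.
  by move=> j; case: odd.
exists x => // i hi; rewrite /tup_a /tup_b !E; try lia.
by rewrite /= odd_double /= doubleK uphalf_double.
Qed.

(** The tuples taken from the graph of an embedding pass the local test and form a closed family: a
    pebble moved to [v] is answered by the image of [v]. Elimination never removes a closed
    family. *)
Lemma contains_survives : contains tau pi -> exists2 x, x < N & survives w k n data x.
Proof.
move=> [f [f1 f2]].
have f1' (a b : 'I_k) : (f a < f b) = (a < b).
  case: (ltngtP a b) => [/f1 //|/f1|/val_inj ->]; lia.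
have f2' (a b : 'I_k) : (tau (f a) < tau (f b)) = (pi a < pi b).
  by apply/idP/idP => /f2.
pose F a : nat := if insub a is Some i then f i else 0.
have FE (i : 'I_k) : F i = f i by rewrite /F valK.
have Fn a : F a < n by rewrite /F; case: insubP => [i _ _|_] //.
pose S x := all (fun i => (tup_a n i x < k) && (tup_b n i x == F (tup_a n i x))) (iota 0 w).
have SP x : reflect (forall i, i < w -> exists2 p : 'I_k, tup_a n i x = p & tup_b n i x = f p) (S x).
  apply: (iffP allP) => h i.
    move=> hi; have hin : i \in iota 0 w by rewrite mem_iota.
    by have /andP [h1 /eqP h2] := h i hin; exists (Ordinal h1); rewrite // h2 -FE.
  rewrite mem_iota /= add0n => /h [p -> ->]; by rewrite FE ltn_ord eqxx.
have S_closed x : x < N -> S x -> forth w k n S x.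
  move=> hx /SP hS; apply/allP => i; rewrite mem_iota /= add0n => hi.
  apply/forallP => v; apply/implyP => hv; pose p := Ordinal hv.
  have [||y hy E] := @tuple_surj (fun j => if j == i then p : nat else tup_a n j x)
     (fun j => if j == i then f p : nat else tup_b n j x).
  - by move=> j; case: eqP => _; [exact: leq_trans (ltn_ord p) le_kn | exact: dig_lt].
  - by move=> j; case: eqP => // _; apply: dig_lt.
  apply/existsP; exists (Ordinal hy); apply/and3P; split=> /=.
  - apply/SP => j hj; have [-> ->] := E j hj; case: eqP => _; first by exists p.
    exact: hS.
  - by have [-> _] := E i hi; rewrite eqxx.
  - apply/allP => j; rewrite mem_iota /= add0n => /E [-> ->].
    by case: eqP => //=; rewrite !eqxx.
have S_local x : x < N -> S x -> local w k n data x.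
  move=> hx /SP hS; apply/andP; split.
    by apply/allP => i; rewrite mem_iota /= add0n => /hS [p -> _].
  apply/allP => -[i j] /allpairsP [[i' j'] /=]; rewrite !mem_iota /= !add0n => -[hi hj [-> ->]].
  have [p Ep Eq] := hS i' hi; have [q Ep' Eq'] := hS j' hj.
  rewrite /compat Ep Eq Ep' Eq' !nth_code_pattern !nth_code_text f2' implybb andbT.
  by rewrite [p <= q]leqNgt [f p <= f q]leqNgt f1' implybb.
have [||x hx E] := @tuple_surj (fun _ => 0) (fun _ => f (Ordinal k_gt0)) => //.
have sub : below N S (survives w k n data).
  by apply: eliminate_closed_below => // al al' y; exact: forth_mono.
exists x => //; apply: sub hx _.
by apply/SP => i /E [-> ->]; exists (Ordinal k_gt0).
Qed.

Lemma survives_local x : x < N -> survives w k n data x -> local w k n data x.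
Proof. exact: eliminate_below. Qed.

Lemma survives_forth x : x < N -> survives w k n data x -> forth w k n (survives w k n data) x.
Proof. by apply: eliminate_closed => al al' y; exact: forth_mono. Qed.

End Soundness.

(** * Consistency decides patterns of bounded treewidth *)

(* [tw adj w X R]: with pebbles on [X], the region [R] can be searched using at most [w] pebbles. *)
Inductive tw (T : finType) (adj : rel T) (w : nat) : {set T} -> {set T} -> Prop :=
  | TwNil (X : {set T}) : tw adj w X set0
  | TwAdd (X R : {set T}) v : #|X| < w -> v \in R -> tw adj w (v |: X) (R :\ v) -> tw adj w X R
  | TwForget (X X' R : {set T}) : X' \subset X ->
      (forall p q, p \in R -> q \in X :\: X' -> ~~ adj p q) -> tw adj w X' R -> tw adj w X R
  | TwUnion (X R1 R2 : {set T}) :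
      (forall p q, p \in R1 -> q \in R2 -> ~~ adj p q) ->
      tw adj w X R1 -> tw adj w X R2 -> tw adj w X (R1 :|: R2).

Section Homomorphism.

Variables (T : finType) (adj : rel T) (w : nat) (U : Type).
Variables (ok : T -> T -> U -> U -> Prop) (fam : {set T} -> (T -> U) -> Prop).
Hypothesis adj_sym : symmetric adj.
Hypothesis ok_sym : forall p q x y, ok p q x y -> ok q p y x.
Hypothesis fam_sub : forall (X X' : {set T}) h, X' \subset X -> fam X h -> fam X' h.
Hypothesis fam_ok : forall (X : {set T}) h p q, fam X h -> p \in X -> q \in X -> ok p q (h p) (h q).
Hypothesis fam_forth : forall (X : {set T}) h v, fam X h -> #|X| < w -> v \notin X ->
  exists c, fam (v |: X) (fun p => if p == v then c else h p).

(** The search strategy is played against the family of partial maps. An added pebble gets its image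
    from [fam_forth]; a union glues two maps that agree on the pebbles, and no edge joins the two
    regions. *)
Lemma tw_hom X R h : tw adj w X R -> [disjoint X & R] -> fam X h ->
  exists g, (forall p, p \in X -> g p = h p) /\
    forall p q, p \in X :|: R -> q \in X :|: R -> adj p q -> ok p q (g p) (g q).
Proof.
move=> H; elim: H h => {X R} [X|X R v cX vR _ IH|X X' R sX nadj _ IH|X R1 R2 nadj _ IH1 _ IH2] h dXR hf.
- by exists h; split=> // p q; rewrite !setU0 => hp hq _; exact: fam_ok hf _ _.
- have vX : v \notin X by rewrite (disjointFl dXR vR).
  have [c hc] := fam_forth hf cX vX.
  have [|g [g1 g2]] := IH _ _ hc.
    rewrite -setI_eq0; apply/eqP/setP => p; rewrite !inE.
    case: eqP => //= _; apply/negP => /andP [pX pR].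
    by rewrite (disjointFr dXR pX) in pR.
  exists g; split=> [p pX|p q hp hq].
    by rewrite g1 ?inE ?pX ?orbT //; case: eqP => // E; rewrite E (negPf vX) in pX.
  by apply: g2; move: hp hq; rewrite !inE; do 2![case: eqP => //=].
- have [||g [g1 g2]] := IH h.
  + by apply: disjointWl sX dXR.
  + exact: fam_sub hf.
  (* [g] agrees with [h] only on [X']. The lifted pebbles get back their old images, which is
     harmless as no edge leads from them into [R]. *)
  exists (fun p => if p \in R then g p else h p).
  split=> [p pX|p q]; first by rewrite (disjointFr dXR pX).
  have key p' q' : p' \in R -> q' \in X -> adj p' q' -> ok p' q' (g p') (h q').
    move=> pR qX a; have qX' : q' \in X'.
      by apply/negPn/negP => n; have := nadj _ _ pR (_ : q' \in X :\: X'); rewrite inE n qX a => /(_ isT).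
    by rewrite -g1 //; apply: g2; rewrite // inE ?pR ?qX' ?orbT.
  rewrite !inE; case: (boolP (p \in R)) => pR; case: (boolP (q \in R)) => qR; rewrite ?orbF ?orbT.
  + by move=> _ _ a; apply: g2; rewrite // inE ?pR ?qR orbT.
  + by move=> _ qX; apply: key.
  + by move=> pX _; rewrite adj_sym => a; apply: ok_sym; apply: key.
  + by move=> pX qX _; apply: fam_ok hf _ _.
- have [|g1 [g11 g12]] := IH1 h _ hf; first by apply: disjointWr dXR; exact: subsetUl.
  have [|g2 [g21 g22]] := IH2 h _ hf; first by apply: disjointWr dXR; exact: subsetUr.
  exists (fun p => if p \in R1 then g1 p else g2 p).
  have dX p : p \in X -> p \notin R1.
    by move=> pX; have := disjointFr dXR pX; rewrite inE; case: (p \in R1).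
  split=> [p pX|p q]; first by rewrite (negPf (dX p pX)) g21.
  have key p' q' : p' \in R1 -> q' \notin R1 -> q' \in X :|: R2 -> adj p' q' -> ok p' q' (g1 p') (g2 q').
    move=> pR qR; rewrite inE => /orP [qX|qR2] a; last by rewrite (negPf (nadj _ _ pR qR2)) in a.
    by rewrite g21 // -(g11 _ qX); apply: g12; rewrite // inE ?pR ?qX ?orbT.
  rewrite !inE; case: (boolP (p \in R1)) => pR; case: (boolP (q \in R1)) => qR; rewrite ?orbT /=.
  + by move=> _ _ a; apply: g12; rewrite // inE ?pR ?qR orbT.
  + by move=> _ hq; apply: key; rewrite // inE.
  + by move=> hp _; rewrite adj_sym => a; apply: ok_sym; apply: key; rewrite // inE.
  + by move=> hp hq a; apply: g22; rewrite // inE.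
Qed.

End Homomorphism.

(** * The graph of a pattern and completeness of consistency *)

Section PatternGraph.

Variables (k : nat) (pi : 'S_k).

Definition padj (p q : 'I_k) : bool :=
  [|| q == p.+1 :> nat, p == q.+1 :> nat, pi q == (pi p).+1 :> nat | pi p == (pi q).+1 :> nat].

Lemma padj_sym : symmetric padj.
Proof.
have H p q : padj p q -> padj q p.
  by case/or4P => h; apply/or4P; [constructor 2|constructor 1|constructor 4|constructor 3].
by move=> p q; apply/idP/idP; exact: H.
Qed.

(** Successor pairs generate a finite linear order; surjectivity of [u] supplies the intermediate
    points. *)
Lemma monotone_of_succ (n : nat) (u : 'I_k -> 'I_k) (v : 'I_k -> 'I_n) :
  (forall i, exists j, u j = i) ->
  (forall p q, u q = (u p).+1 :> nat -> v p < v q) ->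
  forall p q, u p < u q -> v p < v q.
Proof.
move=> su H p q; move E: (u q - u p) => d; elim: d q E => [|d IH] q E lt; first lia.
have hj : (u q).-1 < k by have := ltn_ord (u q); lia.
have [j Ej] := su (Ordinal hj).
have E2 : u j = (u q).-1 :> nat by rewrite Ej.
have ltj : v j < v q by apply: H; lia.
case: (ltngtP (u p) (u j)) => [lt2|lt2|E3]; last 2 first.
- lia.
- by apply: H; lia.
by apply: ltn_trans ltj; apply: IH; lia.
Qed.

Variables (n : nat) (tau : 'S_n).

Definition edge_ok (p q : 'I_k) (x y : 'I_n) : Prop :=
  [/\ p < q -> x < y, q < p -> y < x, pi p < pi q -> tau x < tau y & pi q < pi p -> tau y < tau x].

Lemma contains_of_edges (g : 'I_k -> 'I_n) :
  (forall p q, padj p q -> edge_ok p q (g p) (g q)) -> contains tau pi.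
Proof.
move=> H; exists g; split.
  apply: (@monotone_of_succ n id g) => [i|p q /= E]; first by exists i.
  have [|h _ _ _] := H p q; first by rewrite /padj E eqxx.
  by apply: h; lia.
have mono p q : pi p < pi q -> tau (g p) < tau (g q).
  apply: (@monotone_of_succ n pi (fun p => tau (g p))) => [i|{}p {}q E].
    by exists ((pi^-1)%g i); rewrite permKV.
  have [|_ _ h _] := H p q; first by rewrite /padj E eqxx !orbT.
  by apply: h; lia.
move=> p q; split; last exact: mono.
case: (ltngtP (pi p) (pi q)) => // [/mono|E]; first lia.
have -> : p = q by apply: (@perm_inj _ pi); apply: val_inj.
lia.
Qed.

(** A partial map belongs to [fam] if some surviving tuple lists its graph on [X]; the remaining
    slots may hold anything. *)
Lemma tw_survives_contains w : 0 < w -> 0 < k -> k <= n ->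
  tw padj w set0 setT ->
  (exists2 x, x < n ^ w.*2 & survives w k n (code pi tau) x) -> contains tau pi.
Proof.
move=> w0 k0 kn htw [x0 hx0 sx0].
have n0 : 0 < n by lia.
pose N := n ^ w.*2; pose data := code pi tau.
pose fam (X : {set 'I_k}) (h : 'I_k -> 'I_n) := exists2 x, x < N /\ survives w k n data x &
  forall p, p \in X -> exists2 i, i < w & tup_a n i x = p /\ tup_b n i x = h p.
have compatP x i j : x < N -> survives w k n data x -> i < w -> j < w -> compat k n data x (i, j).
  move=> hx /(survives_local hx) /andP [_ /allP h] hi hj; apply: h.
  by apply/allpairsP; exists (i, j); rewrite !mem_iota.
pose h0 (p : 'I_k) := Ordinal n0.
have [|||||||g [_ Hg]] := @tw_hom _ padj w _ edge_ok fam _ _ _ _ _ set0 setT h0 htw.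
- exact: padj_sym.
- by move=> p q x y [].
- by move=> X X' h /subsetP sX [x hx H]; exists x => // p /sX; exact: H.
- move=> X h p q [x [hx sx] H] /H [i hi [Ei Fi]] /H [j hj [Ej Fj]].
  have /andP [/implyP c1 /implyP c2] := compatP x i j hx sx hi hj.
  have /andP [/implyP c3 /implyP c4] := compatP x j i hx sx hj hi.
  rewrite Ei Ej Fi Fj !nth_code_pattern !nth_code_text in c1 c2 c3 c4.
  have ne : p != q -> h p != h q.
    apply: contra_neq => E; rewrite E in c2 c4; apply: (@perm_inj _ pi); apply: val_inj => /=; lia.
  split=> //; move=> lt.
  + have := c1 (ltnW lt); rewrite leq_eqVlt => /orP [/eqP /val_inj E|//].
    by have := ne; rewrite E eqxx => /(_ _); case: eqP lt => [->|_ _ /(_ isT)] //; rewrite ltnn.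
  + have := c3 (ltnW lt); rewrite leq_eqVlt => /orP [/eqP /val_inj E|//].
    by have := ne; rewrite E eqxx => /(_ _); case: eqP lt => [->|_ _ /(_ isT)] //; rewrite ltnn.
- move=> X h v [x [hx sx] H] cX vX.
  pose slot (p : 'I_k) := odflt (Ordinal w0) [pick i : 'I_w | (tup_a n i x == p :> nat) && (tup_b n i x == h p)].
  have slotP p : p \in X -> tup_a n (slot p) x = p /\ tup_b n (slot p) x = h p.
    move=> /H [i hi [Ei Fi]]; rewrite /slot; case: pickP => [j /andP [/eqP ? /eqP ?] //|].
    by move/(_ (Ordinal hi)); rewrite /= Ei Fi !eqxx.
  (* Fewer than [w] points occupy at most that many slots, so a slot is free to be moved to [v]. *)
  have [i iS] : exists i, i \notin [set slot p | p in X].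
    apply/existsP; rewrite -negb_forall; apply/negP => /forallP hall.
    have := leq_imset_card slot X; rewrite leqNgt => /negP; apply.
    apply: leq_trans cX _; rewrite -{1}(card_ord w) -cardsT; apply: subset_leq_card.
    by apply/subsetP => j _; exact: hall.
  have /allP /(_ i) := survives_forth hx sx; rewrite mem_iota => /(_ (ltn_ord i)) /forallP.
  move=> /(_ (widen_ord kn v)) /implyP /(_ (ltn_ord v)) /existsP [y /and3P [sy /eqP Ev /allP same]].
  exists (Ordinal (dig_lt i.*2.+1 y n0)); exists (y : nat) => // p.
  rewrite !inE; case: eqP => [-> _|_ /= pX]; first by exists i.
  exists (slot p) => //; have [<- <-] := slotP p pX.
  have := same (slot p); rewrite mem_iota => /(_ (ltn_ord _)) /implyP hs.
  suff /hs /andP [/eqP -> /eqP ->] : nat_of_ord (slot p) != i by [].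
  by apply: contraNneq iS => /val_inj <-; apply: imset_f.
- by rewrite -setI_eq0 set0I.
- by exists x0 => // p; rewrite inE.
apply: (@contains_of_edges g) => p q a; apply: Hg => //; by rewrite !inE.
Qed.
End PatternGraph.

(** * Staircases: linear extensions, cuts and grids *)

Section Staircase.

Variables (T : finType) (blk : T -> nat) (lt : rel T).

Definition near (p q : T) : bool := (blk p <= (blk q).+1) && (blk q <= (blk p).+1).

(** Pairwise near points lie in two consecutive blocks, so [lt] is a linear order on each union of
    two consecutive blocks; elsewhere it carries no information. *)
Definition staircase_order : Prop :=
  [/\ forall p, ~~ lt p p,
      forall p q, near p q -> p != q -> lt p q || lt q p &
      forall p q r, near p q -> near q r -> near p r -> lt p q -> lt q r -> lt p r].

Hypothesis st : staircase_order.

Lemma near_sym p q : near p q = near q p. Proof. exact: andbC. Qed.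

Lemma lt_irr p : lt p p = false. Proof. by have [h _ _] := st; exact: negbTE. Qed.

Lemma lt_total p q : near p q -> p != q -> lt p q || lt q p.
Proof. by have [_ h _] := st; exact: h. Qed.

Lemma lt_trans p q r : near p q -> near q r -> near p r -> lt p q -> lt q r -> lt p r.
Proof. by have [_ _ h] := st; exact: h. Qed.

(** This excludes cycles through many blocks. Start at the minimum of the lowest block and, while
    the next block has a point below, pass to its minimum. By transitivity nothing in the block just
    left lies below the new point, so only the following block can object, and the blocks run
    out. *)
Lemma lt_min_exists (U : {set T}) : U != set0 ->
  exists2 p, p \in U & forall q, q \in U -> near q p -> ~~ lt q p.
Proof.
move=> /set0Pn [u0 hu0].
have block_min (b : nat) u : u \in U -> blk u = b ->
  exists2 p, p \in U /\ blk p = b & forall q, q \in U -> blk q = b -> ~~ lt q p.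
  move=> hu Eu; pose V p := [set q in U | (blk q == b) && lt q p].
  have hu' : (u \in U) && (blk u == b) by rewrite hu Eu eqxx.
  have [p /andP [pU /eqP pb] hmin] :=
    @arg_minnP _ u (fun p => (p \in U) && (blk p == b)) (fun p => #|V p|) hu'.
  exists p => // q qU qb.
  apply/negP => ltqp; have := hmin q; rewrite qU qb eqxx => /(_ isT).
  rewrite leqNgt => /negP; apply; apply: proper_card; apply/properP; split.
    apply/subsetP => z; rewrite !inE => /and3P [-> /eqP zb ltzq]; rewrite zb eqxx /=.
    by apply: lt_trans ltzq ltqp; rewrite /near; lia.
  by exists q; rewrite !inE ?qU ?qb ?pb ?eqxx ?lt_irr.
have step d b p : (\max_q blk q).+1 - b <= d -> p \in U -> blk p = b ->
    (forall q, q \in U -> blk q = b -> ~~ lt q p) ->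
    (forall q, q \in U -> (blk q).+1 = b -> ~~ lt q p) ->
    exists2 p, p \in U & forall q, q \in U -> near q p -> ~~ lt q p.
  elim: d b p => [|d IH] b p hd pU pb h1 h2.
    by have := leq_bigmax (F := blk) p; lia.
  case: (boolP [exists q in U, (blk q == b.+1) && lt q p]) => [/existsP [q]|].
    move=> /and3P [qU /eqP qb ltqp].
    have [q0 [q0U q0b] q0min] := block_min _ _ qU qb.
    have ltq0 : lt q0 p.
      case: (eqVneq q0 q) => [->//|ne].
      have := lt_total (_ : near q0 q) ne; rewrite (negPf (q0min q qU qb)) orbF => lq.
      by apply: lt_trans (lq _) ltqp; rewrite /near; lia.
    apply: (IH b.+1 q0) => //; first lia.
    move=> z zU zb; apply/negP => ltz; have {}zb : blk z = b by lia.
    have /negP := h1 z zU zb; apply.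
    by apply: lt_trans ltz ltq0; rewrite /near; lia.
  rewrite negb_exists => /forallP h3; exists p => // q qU; rewrite /near => nqp.
  have [E|[E|E]] : blk q = b \/ (blk q).+1 = b \/ blk q = b.+1 by lia.
  - exact: h1.
  - exact: h2.
  - by have := h3 q; rewrite qU E eqxx.
have [p1] := @arg_minnP _ u0 (fun p => p \in U) blk hu0.
move=> p1U p1min.
have [p [pU pb] pmin] := block_min _ _ p1U erefl.
apply: (step _ _ p (leqnn _)) pU erefl _ _ => q qU qb; first by apply: pmin => //; lia.
by have := p1min q qU; lia.
Qed.

Lemma rank_exists : exists r : T -> nat,
  (forall p, r p < #|T|.+1) /\ forall p q, near p q -> lt p q -> r p < r q.
Proof.
suff H d (U : {set T}) : #|U| = d -> exists r : T -> nat,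
    (forall p, r p < d.+1) /\ forall p q, p \in U -> q \in U -> near p q -> lt p q -> r p < r q.
  have [r [h1 h2]] := H _ setT erefl; exists r; split=> [p|p q]; first by rewrite -cardsT.
  by apply: h2; rewrite inE.
elim: d U => [|d IH] U cU.
  exists (fun _ => 0); split=> // p q; by rewrite (cards0_eq cU) inE.
have [|p pU pmin] := @lt_min_exists U; first by rewrite -card_gt0 cU.
have [|r [h1 h2]] := IH (U :\ p); first by move: cU; rewrite (cardsD1 p) pU; lia.
exists (fun q => if q == p then 0 else (r q).+1); split=> [q|q q' qU q'U nqq' ltqq'].
  by case: ifP => // _; rewrite ltnS.
case: (eqVneq q' p) => [E|ne']; first by have := pmin q qU; rewrite -E nqq' ltqq' => /(_ isT).
case: (eqVneq q p) => // ne; rewrite ltnS; apply: h2 => //; by rewrite !inE ?ne ?ne'.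
Qed.

Definition consecutive (p q : T) : Prop :=
  near p q /\ forall z, blk z = blk p \/ blk z = blk q ->
    ~~ (lt p z && lt z q) && ~~ (lt q z && lt z p).

Lemma consecutive_sym p q : consecutive p q -> consecutive q p.
Proof.
move=> [n h]; split=> [|z hz]; first by rewrite near_sym.
by rewrite andbC; apply: h; case: hz; [right|left].
Qed.

(** Only consecutive pairs have to be blocked here; all other edges of the pattern graph are left to
    the extremal points of the blocks. *)
Definition is_cut (j0 j1 : nat) (Y : {set T}) (left : T -> bool) : Prop :=
  [/\ forall p, blk p < j0 -> left p, forall p, j1 <= blk p -> ~~ left p,
      forall p, p \in Y -> j0 <= blk p < j1 &
      forall p q, consecutive p q -> p \notin Y -> q \notin Y -> left p = left q].

Variable r : T -> nat.
Hypothesis r_mono : forall p q, near p q -> lt p q -> r p < r q.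

Lemma lt_r p q : near p q -> p != q -> lt p q = (r p < r q).
Proof.
move=> n ne; apply/idP/idP; first exact: r_mono.
have := lt_total n ne => /orP [-> //|]; rewrite near_sym in n => /(r_mono n); lia.
Qed.

Lemma r_inj p q : near p q -> r p = r q -> p = q.
Proof.
move=> n E; apply/eqP/negPn/negP => ne.
by have := lt_total n ne; rewrite !lt_r ?E ?ltnn // 1?near_sym // eq_sym.
Qed.

(** * Zigzags, cuts and grids in a window of blocks *)

Section Window.

Variables (j0 j1 : nat).

Definition in_window (p : T) : bool := j0 <= blk p < j1.

(** [Y] is the trace of a zigzag that has arrived at [y]. The separation may still leak, but only at
    points above [y] in its block; a point whose side disagrees with its block number relative to
    [y] has smaller rank than [y]. *)
Definition cut_inv (Y : {set T}) (left : T -> bool) (y : T) : Prop :=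
  [/\ y \in Y /\ (forall p, p \in Y -> in_window p),
      forall p, blk p < j0 -> left p, forall p, j1 <= blk p -> ~~ left p,
      forall p q, consecutive p q -> p \notin Y -> q \notin Y -> left p != left q ->
        (blk p == blk y) && lt y p || (blk q == blk y) && lt y q &
      forall p, (if left p then blk y < blk p else blk p < blk y) -> r p < r y].

Definition flush (y : T) (d : bool) (left : T -> bool) (p : T) : bool :=
  if (blk p == blk y) && lt y p then d else left p.

(* The cut follows the path up to [y] and then leaves the block of [y] towards the block [b']:
   everything above [y] in its block goes to the opposite side. *)
Lemma cut_flush Y left y (d : bool) b' : cut_inv Y left y ->
  (if d then b' = (blk y).+1 else blk y = b'.+1) ->
  [/\ forall p, blk p < j0 -> flush y d left p, forall p, j1 <= blk p -> ~~ flush y d left p,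
      forall p q, consecutive p q -> p \notin Y -> q \notin Y -> flush y d left p != flush y d left q ->
        (blk p == b') && lt y p || (blk q == b') && lt y q &
      forall p, (if flush y d left p then b' < blk p else blk p < b') -> r p <= r y].
Proof.
move=> [[yY Yw] L1 L2 I1 I2] hb.
have yw := Yw y yY; rewrite /in_window in yw.
have below_y p : blk p = blk y -> ~~ lt y p -> r p <= r y.
  move=> E; case: (eqVneq p y) => [-> //|ne]; rewrite lt_r 1?eq_sym // /near; lia.
split.
- by move=> p hp; rewrite /flush ifF ?L1 //; lia.
- by move=> p hp; rewrite /flush ifF ?L2 //; lia.
(* The point [q] lies above [y], since otherwise [y] would lie between [q] and [p]. Then [I2] leaves
   only the block [b'] for it. *)
- have key p q : consecutive p q -> p \notin Y -> q \notin Y -> (blk p == blk y) && lt y p ->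
      ~~ ((blk q == blk y) && lt y q) -> left q != d -> (blk q == b') && lt y q.
    move=> [npq hpq] pY qY /andP [/eqP pb ltyp] nq lq.
    have ney : q != y by apply: contraNneq qY => ->.
    have nyq : near y q by move: npq; rewrite /near pb.
    have ltyq : lt y q.
      have := lt_total nyq; rewrite eq_sym => /(_ ney) /orP [//|ltqy].
      by have := hpq y (or_introl (esym pb)); rewrite ltqy ltyp /= andbF.
    rewrite ltyq andbT in nq *; have ry := r_mono nyq ltyq.
    have := I2 q; move: npq lq hb; rewrite /near; case: d; case: (left q) => //= npq _ hb H.
      apply/negPn/negP => ne; suff : r q < r y by lia.
      by apply: H; lia.
    apply/negPn/negP => ne; suff : r q < r y by lia.
    by apply: H; lia.
  move=> p q cpq pY qY; rewrite /flush.
  case: ifPn => zp; case: ifPn => zq; first by rewrite eqxx.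
  + by rewrite eq_sym => lq; rewrite (key _ _ cpq pY qY zp zq lq) orbT.
  + by move=> lp; rewrite (key _ _ (consecutive_sym cpq) qY pY zq zp lp).
  + by move=> lpq; have := I1 p q cpq pY qY lpq; rewrite (negPf zp) (negPf zq).
- move=> p; rewrite /flush.
  case: (boolP ((blk p == blk y) && lt y p)) => [/andP [/eqP E lyp]|nz].
    by move: hb; case: d => hb; rewrite E; lia.
  case: (eqVneq (blk p) (blk y)) => [E _|ne].
    by apply: below_y => //; move: nz; rewrite E eqxx.
  have := I2 p; move: hb; case: d; case: (left p) => hb H h; apply: ltnW; apply: H; lia.
Qed.

Definition block_min (y : T) : bool :=
  [forall q, (blk q == blk y) ==> (q == y) || lt y q].

Definition next_min (y y' : T) : bool :=
  [&& (blk y' == (blk y).+1) || (blk y == (blk y').+1), lt y y' &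
    [forall q, (blk q == blk y') && lt y q ==> (q == y') || lt y' q]].

Fixpoint reached (s : nat) : {set T} :=
  if s is s'.+1 then
    reached s' :|: [set y' | in_window y' && [exists y in reached s', next_min y y']]
  else [set y | in_window y && block_min y].

(** One point is added per step. Flushing moves the leak to the block just entered; its points above
    the previous stop are [y], which joins [Y], and points above [y]. *)
Lemma reached_cut_inv s y : y \in reached s ->
  exists (Y : {set T}) left, #|Y| <= s.+1 /\ cut_inv Y left y.
Proof.
elim: s y => [|s IH] y /=.
  rewrite inE => /andP [yw /forallP ymin].
  exists [set y], (fun p => blk p < blk y); split; first by rewrite cards1.
  rewrite /in_window in yw; split.
  - by rewrite set11; split=> // p /set1P ->.
  - by move=> p hp; lia.
  - by move=> p hp; lia.
  - have key p q : consecutive p q -> q \notin [set y] -> blk p < blk y -> ~~ (blk q < blk y) ->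
       (blk q == blk y) && lt y q.
      move=> [npq _]; rewrite inE => ney h1 h2.
      have E : blk q == blk y by move: npq; rewrite /near; lia.
      by have := ymin q; rewrite E (negPf ney).
    move=> p q cpq pY qY; case: (boolP (blk p < blk y)) => hp; case: (boolP (blk q < blk y)) => hq // _.
      by rewrite (key p q) ?orbT.
    by rewrite (key q p) //; exact: consecutive_sym.
  - by move=> p; case: ltnP; lia.
rewrite !inE => /orP [/IH [Y [left [cY I]]]|]; first by exists Y, left; split=> //; lia.
move=> /andP [y'w /existsP [x /andP [/IH [Y [left [cY I]]]]]].
move=> /and3P [hb ltxy /forallP ymin].
pose d := blk y == (blk x).+1.
have [|L1 L2 I1 I2] := @cut_flush Y left x d (blk y) I.
  by rewrite /d; case: eqP hb => //= _ /eqP.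
have nxy : near x y by rewrite /near; lia.
exists (y |: Y), (flush x d left); split.
  by rewrite cardsU1; case: (_ \in _) => /=; lia.
have [[_ Yw] _ _ _ _] := I.
split=> //.
- rewrite setU11; split=> // p; rewrite !inE => /orP [/eqP -> //|]; exact: Yw.
- move=> p q cpq; rewrite !inE !negb_or => /andP [npy pY] /andP [nqy qY] hl.
  case/orP: (I1 p q cpq pY qY hl) => /andP [E l]; apply/orP; [left|right].
    by have := ymin p; rewrite E l (negPf npy) /= => ->.
  by have := ymin q; rewrite E l (negPf nqy) /= => ->.
- by move=> p /I2; have := r_mono nxy ltxy; lia.
Qed.

Lemma cut_of_empty_block j : j0 <= j < j1 -> (forall p, blk p != j) ->
  is_cut j0 j1 set0 (fun p => blk p < j).
Proof.
move=> hj hp; split=> [p h|p h|p|p q [npq _] _ _]; rewrite ?inE //; try lia.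
by move: npq; rewrite /near; have := hp p; have := hp q; case: ltnP; case: ltnP => //; lia.
Qed.

Lemma cut_of_stuck s y j : y \in reached s -> (j == (blk y).+1) || (blk y == j.+1) ->
  (forall q, blk q = j -> ~~ lt y q) ->
  exists (Y : {set T}) left, #|Y| <= s.+1 /\ is_cut j0 j1 Y left.
Proof.
move=> /reached_cut_inv [Y [left [cY I]]] hj stuck.
pose d := j == (blk y).+1.
have [|L1 L2 I1 _] := @cut_flush Y left y d j I.
  by rewrite /d; case: eqP hj => //= _ /eqP.
exists Y, (flush y d left); split=> //; have [[_ Yw] _ _ _ _] := I; split=> // p q cpq pY qY.
apply/eqP/negPn/negP => hl.
by case/orP: (I1 p q cpq pY qY hl) => /andP [/eqP /stuck /negPf ->].
Qed.

Definition top (s j : nat) (y : T) : bool :=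
  [&& y \in reached s, blk y == j & [forall z in reached s, (blk z == j) ==> (r z <= r y)]].

Variable S : nat.
Hypothesis no_cut : forall Y left, is_cut j0 j1 Y left -> S.+1 < #|Y|.

Lemma reached_sub s s' : s <= s' -> reached s \subset reached s'.
Proof.
move=> /subnK <-; elim: (s' - s) => [|d IH] //=.
by apply: subset_trans IH _; exact: subsetUl.
Qed.

Lemma top_exists s j : j0 <= j < j1 -> exists y, top s j y.
Proof.
move=> hj.
have [p0 hp0] : exists p, blk p == j.
  apply/existsP; rewrite -[[exists _, _]]negbK negb_exists; apply/negP => /forallP h.
  by have := no_cut (cut_of_empty_block hj h); rewrite cards0.
have [p /eqP pb pmin] := @arg_minnP _ p0 (fun p => blk p == j) r hp0.
have pr : (p \in reached s) && (blk p == j).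
  rewrite pb eqxx andbT; apply: (subsetP (reached_sub (leq0n s))).
  rewrite inE /in_window pb hj; apply/forallP => q; apply/implyP => /eqP qb.
  case: (eqVneq q p) => //= ne; rewrite lt_r ?[p == q]eq_sym //; last by rewrite /near; lia.
  have := pmin q; rewrite qb pb eqxx => /(_ isT); rewrite leq_eqVlt => /orP [/eqP E|//].
  by case/eqP: ne; apply: r_inj; rewrite // /near; lia.
have [y /andP [yr yb] ymax] := @arg_maxnP _ p (fun p => (p \in reached s) && (blk p == j)) r pr.
exists y; rewrite /top yr yb; apply/forallP => z; apply/implyP => zr; apply/implyP => zb.
by apply: ymax; rewrite zr.
Qed.

(** If [y] had nothing above it in block [j'], there would be a small cut. So the zigzag moves on to
    the lowest such point, which is reached by step [s'] and therefore is not above [y']. *)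
Lemma top_adjacent s s' j j' y y' : s < s' -> s' <= S -> j0 <= j' < j1 ->
  (j' == j.+1) || (j == j'.+1) -> top s j y -> top s' j' y' -> lt y y'.
Proof.
move=> ss' sS hj' hjj' ty ty'; have /and3P [yr /eqP yb _] := ty.
have [q0 /andP [q0b q0l]] : exists q, (blk q == j') && lt y q.
  apply/existsP; rewrite -[[exists _, _]]negbK negb_exists; apply/negP => /forallP h.
  have [||Y [left [cY hcut]]] := @cut_of_stuck s y j' yr; first by rewrite yb.
    by move=> q qb; have := h q; rewrite qb eqxx.
  by have := no_cut hcut; lia.
have [z /andP [/eqP zb zl] zmin] :=
  @arg_minnP _ q0 (fun q => (blk q == j') && lt y q) r (introT andP (conj q0b q0l)).
have zr : z \in reached s.+1.
  rewrite /= !inE /in_window zb hj' /=; apply/orP; right; apply/existsP; exists y.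
  rewrite yr /next_min zb yb hjj' zl /=; apply/forallP => q; apply/implyP => hq.
  case: (eqVneq q z) => //= ne; have /andP [/eqP qb _] := hq.
  rewrite lt_r ?[z == q]eq_sym //; last by rewrite /near; lia.
  have := zmin q hq; rewrite leq_eqVlt => /orP [/eqP E|//].
  by case/eqP: ne; apply: r_inj; rewrite // /near; lia.
have /and3P [_ /eqP y'b /forallP h] := ty'.
have := h z; rewrite (subsetP (reached_sub ss')) //= zb eqxx /= leq_eqVlt => /orP [/eqP E|lt1].
  by have -> : y' = z by apply: r_inj; rewrite // /near; lia.
have lzy : lt z y'.
  rewrite lt_r //; last by apply: contraTneq lt1 => ->; rewrite ltnn.
  by rewrite /near; lia.
by apply: lt_trans zl lzy; rewrite /near; lia.
Qed.

(** Zigzags always change the block, so the comparison goes through a top of a neighbouring block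
    and costs two steps. This is why ranks are doubled later. *)
Lemma top_same s s' j y y' : s.+1 < s' -> s' <= S -> j0 <= j < j1 -> j0.+1 < j1 ->
  top s j y -> top s' j y' -> lt y y'.
Proof.
move=> ss' sS hj hw ty ty'.
pose j' := if j.+1 < j1 then j.+1 else j.-1.
have hj' : j0 <= j' < j1 by rewrite /j'; case: ifP; lia.
have adj1 : (j' == j.+1) || (j == j'.+1) by rewrite /j'; case: ifP; lia.
have [z tz] := top_exists s.+1 hj'.
have l1 : lt y z by apply: top_adjacent ty tz => //; lia.
have l2 : lt z y' by apply: top_adjacent tz ty' => //; lia.
have /and3P [_ /eqP yb _] := ty; have /and3P [_ /eqP y'b _] := ty'; have /and3P [_ /eqP zb _] := tz.
by apply: lt_trans l1 l2; rewrite /near; lia.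
Qed.

End Window.
End Staircase.

(** * Treewidth from cuts *)

Section Sweep.

Variables (T : finType) (blk : T -> nat) (lt : rel T) (r : T -> nat).
Hypothesis st : staircase_order blk lt.
Hypothesis r_mono : forall p q, near blk p q -> lt p q -> r p < r q.
Variable (adj : rel T).

Lemma card_blk_inj (A : {set T}) a m : {in A &, injective blk} ->
  (forall p, p \in A -> a <= blk p < a + m) -> #|A| <= m.
Proof.
move=> inj hA; rewrite cardE -(size_map blk) -(size_iota a m).
apply: uniq_leq_size.
  by rewrite map_inj_in_uniq ?enum_uniq // => p q; rewrite !mem_enum; exact: inj.
by move=> b /mapP [p]; rewrite mem_enum => /hA h ->; rewrite mem_iota.
Qed.

Lemma tw_add_set w (X R A : {set T}) : A \subset R -> #|X :|: A| <= w -> [disjoint X & R] ->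
  tw adj w (X :|: A) (R :\: A) -> tw adj w X R.
Proof.
move E: #|A| => d; elim: d X R A E => [|d IH] X R A cA sAR.
  by rewrite (cards0_eq cA) setU0 setD0.
have [a aA] : exists a, a \in A by apply/set0Pn; rewrite -card_gt0 cA.
move=> cw dXR h; have aR := subsetP sAR a aA.
have aX : a \notin X by rewrite (disjointFl dXR aR).
have E1 : (a |: X) :|: (A :\ a) = X :|: A.
  by apply/setP => x; rewrite !inE; case: eqP => [->|_] /=; rewrite ?aA ?orbT.
apply: (TwAdd (v := a)) => //.
  apply: leq_trans cw; apply: proper_card; apply/properP; split; first exact: subsetUl.
  by exists a; rewrite // inE aA orbT.
apply: (IH _ _ (A :\ a)).
- by move: cA; rewrite (cardsD1 a) aA; lia.
- by apply: setSD.
- by rewrite E1.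
- rewrite -setI_eq0; apply/eqP/setP => x; rewrite !inE; case: eqP => //= _.
  by apply/negP => /andP [xX xR]; rewrite (disjointFr dXR xX) in xR.
rewrite E1; suff -> : (R :\ a) :\: (A :\ a) = R :\: A by [].
by apply/setP => x; rewrite !inE; case: eqP => [->|_] //=; rewrite aA.
Qed.

(** Points are pebbled in the order of [r], and in each block only the latest keeps its pebble. An
    earlier point of that block cannot be consecutive to a point still to come, because the latest
    one lies between them. *)
Lemma tw_sweep w (X M : {set T}) a m :
  (forall p, p \in M -> a <= blk p < a + m) ->
  (forall p q, p \in M -> q \in M -> adj p q -> consecutive blk lt p q) ->
  #|X| + m < w -> tw adj w X M.
Proof.
move=> hM hadj hw.
pose front (U : {set T}) := [set p in M :\: U |
  [forall q in M :\: U, (blk q == blk p) ==> (r q <= r p)]].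
have frontP U p q : p \in front U -> q \in M -> q \notin U -> blk q = blk p -> r q <= r p.
  rewrite !inE => /andP [_ /forallP h] qM qU /eqP qb.
  by have := h q; rewrite !inE qU qM qb.
have card_front U : #|front U| <= m.
  apply: (@card_blk_inj _ a); last by move=> p; rewrite !inE => /andP [/andP [_ /hM]].
  move=> p q hp hq E.
  have [pM pU] : p \in M /\ p \notin U by move: hp; rewrite !inE => /andP [/andP []].
  have [qM qU] : q \in M /\ q \notin U by move: hq; rewrite !inE => /andP [/andP []].
  apply: (r_inj st r_mono); first by rewrite /near E; lia.
  by apply/eqP; rewrite eqn_leq (frontP U q p) // (frontP U p q).
suff H d (U : {set T}) : #|U| = d -> U \subset M ->
    (forall p q, p \in M -> p \notin U -> q \in U -> r p <= r q) ->
    tw adj w (X :|: front U) U.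
  have := H _ M erefl (subxx M); suff -> : front M = set0.
    by rewrite setU0; apply => p q ->.
  by apply/setP => p; rewrite !inE; case: (p \in M).
elim: d U => [|d IH] U cU sUM hU; first by rewrite (cards0_eq cU); exact: TwNil.
have [u0 u0U] : exists u, u \in U by apply/set0Pn; rewrite -card_gt0 cU.
have [v vU vmin] := @arg_minnP _ u0 (fun u => u \in U) r u0U.
have vM := subsetP sUM v vU.
have hU' p q : p \in M -> p \notin U :\ v -> q \in U :\ v -> r p <= r q.
  rewrite !inE negb_and negbK => pM /orP [/eqP ->|pU] /andP [_ qU]; first exact: vmin.
  exact: hU.
apply: (TwAdd (v := v)) => //.
  by apply: leq_ltn_trans hw; apply: leq_trans (leq_card_setU _ _) _; rewrite leq_add2l.
apply: (@TwForget _ _ _ _ (X :|: front (U :\ v))).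
- apply/subsetP => p; rewrite !inE => /orP [-> |]; first by rewrite orbT.
  move=> /andP [/andP [nU pM] /forallP h].
  case: (eqVneq p v) => //= ne; rewrite ne /= in nU; rewrite nU pM /=.
  apply/orP; right; apply/forallP => q; apply/implyP; rewrite !inE => /andP [qU qM].
  by have := h q; rewrite !inE (negPf qU) qM andbF.
- move=> p z pU'; rewrite in_setD in_setU negb_or in_setU1 in_setU => /andP [/andP [nzX nzf]].
  rewrite (negPf nzX) /= => hz; apply/negP => apz.
  have pM : p \in M by move: pU'; rewrite !inE => /andP [_ /(subsetP sUM)].
  have [zM zU] : z \in M /\ z \notin U :\ v.
    case/orP: hz => [/eqP ->|]; first by rewrite !inE eqxx.
    by rewrite !inE => /andP [/andP [/negPf -> ->] _]; rewrite andbF.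
  have [npz hc] := hadj p z pM zM apz.
  have [q [qM qU qb ltzq]] : exists q, [/\ q \in M, q \notin U :\ v, blk q = blk z & r z < r q].
    move: nzf; rewrite inE in_setD zU zM /= negb_forall => /existsP [q].
    by rewrite !negb_imply -ltnNge in_setD => /and3P [/andP [h1 h2] /eqP h3 h4]; exists q.
  have lzq : lt z q.
    have nzq : near blk z q by rewrite /near qb leqnSn.
    have nezq : z != q by apply: contraTneq ltzq => ->; rewrite ltnn.
    by rewrite (lt_r st r_mono nzq nezq).
  have nqp : near blk q p by move: npz; rewrite near_sym /near qb.
  have neq : q != p by apply: contraNneq qU => ->.
  have lqp : lt q p.
    have := lt_total st nqp neq => /orP [//|lpq].
    have := r_mono (_ : near blk p q) lpq; rewrite near_sym => /(_ nqp).
    by rewrite ltnNge (hU' q p).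
  by have := hc q (or_intror qb); rewrite lzq lqp andbF.
- apply: IH => //; first by move: cU; rewrite (cardsD1 v) vU => -[].
  by apply: subset_trans sUM; apply: subD1set.
Qed.

Definition block_ext (p : T) : bool :=
  [forall z, (blk z == blk p) ==> (r p <= r z)] || [forall z, (blk z == blk p) ==> (r z <= r p)].

Lemma card_block_ext a m : #|[set p | block_ext p && (a <= blk p < a + m)]| <= m.*2.
Proof.
pose A := [set p | [forall z, (blk z == blk p) ==> (r p <= r z)] && (a <= blk p < a + m)].
pose B := [set p | [forall z, (blk z == blk p) ==> (r z <= r p)] && (a <= blk p < a + m)].
have -> : [set p | block_ext p && (a <= blk p < a + m)] = A :|: B.
  by apply/setP => p; rewrite !inE /block_ext andb_orl.
apply: leq_trans (leq_card_setU _ _) _; rewrite -addnn.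
apply: leq_add; apply: (@card_blk_inj _ a) => [p q|p]; rewrite !inE; try by case/andP.
- move=> /andP [/forallP hp _] /andP [/forallP hq _] E.
  apply: (r_inj st r_mono); first by rewrite /near E; lia.
  by have := hp q; have := hq p; rewrite E eqxx /=; lia.
- move=> /andP [/forallP hp _] /andP [/forallP hq _] E.
  apply: (r_inj st r_mono); first by rewrite /near E; lia.
  by have := hp q; have := hq p; rewrite E eqxx /=; lia.
Qed.

Hypothesis adj_cons : forall p q, adj p q -> consecutive blk lt p q \/
  [/\ block_ext p, block_ext q, blk p <= blk q + 5 & blk q <= blk p + 5].

Variables (W c : nat).
Hypothesis W_gt : 5 < W.
Hypothesis cuts : forall m, exists (Y : {set T}) left,
  #|Y| <= c /\ is_cut blk lt (m * W) (m.+1 * W) Y left.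

(** Edges between extremal points span at most 5 blocks, fewer than a window. The extremal points of
    the window of the cut and of its two neighbours therefore block all those that cross the cut. *)
Definition pebbles (m : nat) (Y : {set T}) : {set T} :=
  Y :|: [set p | block_ext p && (m.-1 * W <= blk p < m.-1 * W + 3 * W)].

Definition beyond (m : nat) (Y : {set T}) (left : T -> bool) : {set T} :=
  [set p | ~~ left p] :\: pebbles m Y.

Lemma card_pebbles m (Y : {set T}) : #|Y| <= c -> #|pebbles m Y| <= c + 6 * W.
Proof.
move=> cY; apply: leq_trans (leq_card_setU _ _) _; apply: leq_add => //.
by apply: leq_trans (card_block_ext _ _) _; lia.
Qed.

Lemma pebbles_separate m Y left p q : is_cut blk lt (m * W) (m.+1 * W) Y left ->
  p \notin pebbles m Y -> q \notin pebbles m Y -> left p != left q -> ~~ adj p q.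
Proof.
move=> [L1 L2 Yw hY].
have key p' q' : p' \notin pebbles m Y -> block_ext p' -> left p' -> ~~ left q' ->
    blk q' <= blk p' + 5 -> False.
  rewrite !inE negb_or => /andP [_ h1] h2 l1 l2 h3.
  have h4 : blk p' < m.+1 * W.
    by rewrite ltnNge; apply/negP => h; have := L2 p' h; rewrite l1.
  have h5 : m * W <= blk q'.
    by rewrite leqNgt; apply/negP => h; have := L1 q' h; rewrite (negPf l2).
  by rewrite h2 /= in h1; case: m h1 h4 h5 {L1 L2 Yw hY} => [|m] /=; nia.
move=> pX qX hl; apply/negP => /adj_cons [hc|[e1 e2 d1 d2]].
  case/eqP: hl; apply: hY hc _ _.
    by move: pX; rewrite inE negb_or => /andP [].
  by move: qX; rewrite inE negb_or => /andP [].
case lp : (left p); case lq : (left q); rewrite lp lq // in hl.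
- by apply: (key p q) => //; rewrite lq.
- by apply: (key q p) => //; rewrite lp.
Qed.

(** Room for two successive separators, for a front with one point in each of the [2 * W] blocks
    between them, and for the pebble being placed. *)
Let w := (c + 6 * W).*2 + 2 * W + 1.

(** Induction on the windows left. Once the part of the next separator that lies ahead is pebbled,
    the rest splits into the points between the cuts, which are swept, and the points beyond the
    next cut, for which the old separator can be lifted. *)
Lemma tw_beyond d m (Y : {set T}) left : \max_p blk p < (m + d) * W -> #|Y| <= c ->
  is_cut blk lt (m * W) (m.+1 * W) Y left -> tw adj w (pebbles m Y) (beyond m Y left).
Proof.
elim: d m Y left => [|d IH] m Y left hd cY hcut.
  suff -> : beyond m Y left = set0 by exact: TwNil.
  apply/setP => p; have [L1 _ _ _] := hcut; rewrite !inE L1 ?andbF //.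
  by apply: leq_ltn_trans (leq_bigmax p) _; rewrite addn0 in hd.
have [Y' [left' [cY' hcut']]] := cuts m.+1.
have [L1 L2 Yw _] := hcut; have [L1' L2' Yw' _] := hcut'.
have l_lt p : left p -> blk p < m.+1 * W.
  by move=> l; rewrite ltnNge; apply/negP => /L2; rewrite l.
have l_ge p : ~~ left p -> m * W <= blk p.
  by move=> l; rewrite leqNgt; apply/negP => /L1; rewrite (negPf l).
have l'_lt p : left' p -> blk p < m.+2 * W.
  by move=> l; rewrite ltnNge; apply/negP => /L2'; rewrite l.
have l'_ge p : ~~ left' p -> m.+1 * W <= blk p.
  by move=> l; rewrite leqNgt; apply/negP => /L1'; rewrite (negPf l).
set X := pebbles m Y; set X' := pebbles m.+1 Y'.
have inX p : (p \in X) = (p \in Y) || block_ext p && (m.-1 * W <= blk p < m.-1 * W + 3 * W).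
  by rewrite !inE.
have inX' p : (p \in X') = (p \in Y') || block_ext p && (m * W <= blk p < m * W + 3 * W).
  by rewrite !inE.
have mW : m.-1 * W <= m * W /\ m * W <= m.-1 * W + W by case: (m) => //= m'; lia.
pose A := X' :&: beyond m Y left.
pose M := [set p | ~~ left p && left' p] :\: (X :|: X').
have cXX : #|X :|: A| <= (c + 6 * W).*2.
  apply: leq_trans (leq_card_setU _ _) _; rewrite -addnn; apply: leq_add; first exact: card_pebbles.
  by apply: leq_trans (card_pebbles m.+1 cY'); apply: subset_leq_card; exact: subsetIl.
have inB q : (q \in beyond m Y left) = (q \notin X) && ~~ left q by rewrite in_setD inE.
have inB' q : (q \in beyond m.+1 Y' left') = (q \notin X') && ~~ left' q by rewrite in_setD inE.
have inM q : (q \in M) = ((q \notin X) && (q \notin X')) && (~~ left q && left' q).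
  by rewrite in_setD in_setU negb_or inE.
have ER : beyond m Y left :\: A = M :|: beyond m.+1 Y' left'.
  apply/setP => p; rewrite in_setD in_setI in_setU inB inB' inM.
  have F : p \notin X' -> ~~ left' p -> (p \notin X) && ~~ left p.
    move=> pX' lp'; have := l'_ge p lp' => hp; rewrite L2 // andbT.
    move: pX'; rewrite inX inX' !negb_or => /andP [_ h].
    apply/andP; split; first by apply/negP => /Yw; rewrite [X in _ && X]ltnNge hp andbF.
    apply: contraNN h => /andP [-> /andP [_ h2]] /=.
    by have [h3 h4] := mW; move: hp h2 h3 h4; clear; lia.
  case: (boolP (p \in X')) => pX' /=; first by rewrite andbF /= andNb.
  case: (boolP (left' p)) => lp' /=; first by rewrite orbF !andbT.
  by rewrite F // orbT.
apply: (@tw_add_set w _ _ A); first exact: subsetIr.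
- by apply: leq_trans cXX _; rewrite /w; lia.
- by rewrite -setI_eq0 /beyond setIDA setIC -setIDA setDv setI0.
rewrite ER; apply: TwUnion.
- move=> p q; rewrite inM inB' => /andP [/andP [_ pX] /andP [_ lp]] /andP [qX lq].
  by apply: (pebbles_separate hcut') => //; rewrite lp (negPf lq).
- apply: (@tw_sweep _ _ _ (m * W) (2 * W)).
  + move=> p; rewrite inM => /andP [_ /andP [lp lp']].
    by have := l_ge p lp; have := l'_lt p lp'; clear; lia.
  + move=> p q; rewrite inM => /andP [/andP [pX _] /andP [lp lp']] _.
    move/adj_cons => [//|[e1 _ _ _]]; case/negP: pX; rewrite inX e1 /=.
    by have := l_ge p lp; have := l'_lt p lp'; move: mW; clear; lia.
  + by rewrite /w; lia.
- apply: (@TwForget _ _ _ _ X').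
  + apply/subsetP => p pX'; rewrite in_setU in_setI pX' inB.
    case: (boolP (p \in X)) => //= pX; apply/negP => lp.
    have := l_lt p lp; move: pX'; rewrite inX' => /orP [/Yw'|/andP [e h1]]; first by clear; lia.
    by move: pX h1 mW; rewrite inX e /=; clear; lia.
  + move=> p q; rewrite inB' => /andP [pX' lp'].
    rewrite in_setD in_setU in_setI => /andP [qX']; rewrite (negPf qX') orbF => qX.
    apply: (pebbles_separate hcut') => //; rewrite (negPf lp') eq_sym.
    suff -> : left' q by [].
    apply: L1'; move: qX qX'; rewrite inX inX' negb_or => /orP [/Yw/andP [_ //]|/andP [-> h1] /andP [_]].
    by move: mW h1; clear=> /=; lia.
  + by apply: IH => //; rewrite addSnnS.
Qed.

Lemma tw_of_cuts : tw adj w set0 setT.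
Proof.
have [Y [left [cY hcut]]] := cuts 0; have [L1 L2 Yw _] := hcut.
set X := pebbles 0 Y.
apply: (@tw_add_set w _ _ X); first exact: subsetT.
- by rewrite set0U; apply: leq_trans (card_pebbles 0 cY) _; rewrite /w; clear; lia.
- by rewrite -setI_eq0 set0I.
pose M := [set p | left p] :\: X.
have -> : setT :\: X = M :|: beyond 0 Y left.
  by apply/setP => p; rewrite !in_setD in_setU !in_setD !inE; case: (left p); rewrite /= ?andbT ?andbF ?orbF.
rewrite set0U; apply: TwUnion.
- move=> p q; rewrite !in_setD !inE => /andP [pX lp] /andP [qX lq].
  apply: (pebbles_separate hcut); rewrite ?lp ?(negPf lq) // !inE; [exact: pX|exact: qX].
- apply: (@tw_sweep _ _ _ 0 (2 * W)).
  + move=> p; rewrite in_setD inE => /andP [_ lp]; rewrite leq0n add0n /= ltnNge.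
    apply/negP => h; have := L2 p; rewrite lp => /(_ _); case/(_ _)/notF.
    by move: h; clear; lia.
  + move=> p q; rewrite in_setD inE => /andP [pX lp] _.
    move/adj_cons => [//|[e1 _ _ _]]; case/negP: pX; rewrite !inE e1 /= add0n; apply/orP; right.
    rewrite ltnNge; apply/negP => h; have := L2 p; rewrite lp => /(_ _); case/(_ _)/notF.
    by move: h; clear; lia.
  + have := card_pebbles 0 cY; rewrite -/X /w; clear; lia.
- apply: (@tw_beyond (\max_p blk p).+1) hcut => //.
  by rewrite add0n; apply: leq_pmulr; move: W_gt; clear; lia.
Qed.

End Sweep.

(** * Spirals *)

(* The blocks, numbered along the spiral from the outside to the inside, are grouped by [pr] into
   pairs that occupy consecutive intervals of the coordinate [u]; [s i] tells whether the pair [i]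
   lies on the low side of all later pairs, and [lt] means closer to the centre. *)
Definition axis k (blk : 'I_k -> nat) (lt : rel 'I_k) (u : 'I_k -> 'I_k)
    (pr : nat -> nat) (s : nat -> bool) : Prop :=
  [/\ injective u,
      forall p q, pr (blk p) < pr (blk q) -> (u p < u q) = s (pr (blk p)) &
      forall p q, pr (blk p) = pr (blk q) -> near blk p q /\
        lt p q = if s (pr (blk p)) then u q < u p else u p < u q].

(** Blocks [2 i] and [2 i + 1] share a column, blocks [2 i - 1] and [2 i] a row. The last clause
    forbids gaps from block 4 on, which keeps neighbours in position or value at bounded block
    distance. *)
Definition spiral k (pi : 'S_k) (blk : 'I_k -> nat) (lt : rel 'I_k) : Prop :=
  [/\ axis blk lt id half (fun i => ~~ odd i), axis blk lt pi uphalf odd &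
      forall p j, 3 < j <= blk p -> exists z, blk z = j].

(** * Neighbours in one coordinate of a spiral *)

Section Axis.

Variables (k : nat) (blk : 'I_k -> nat) (lt : rel 'I_k).
Variables (u : 'I_k -> 'I_k) (pr : nat -> nat) (s : nat -> bool).
Hypothesis ax : axis blk lt u pr s.

Lemma axis_irr p : ~~ lt p p.
Proof. by have [_ _ h] := ax; have [_ ->] := h p p erefl; rewrite ltnn if_same. Qed.

Lemma axis_total p q : pr (blk p) = pr (blk q) -> p != q -> lt p q || lt q p.
Proof.
have [inj _ h] := ax => E ne; have [_ ->] := h p q E; have [_ ->] := h q p (esym E).
have : u p != u q by apply: contra_neq ne; exact: inj.
by rewrite E -val_eqE neq_ltn; case: (s _); rewrite // orbC.
Qed.

Lemma axis_trans p q t : pr (blk p) = pr (blk q) -> pr (blk q) = pr (blk t) ->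
  lt p q -> lt q t -> lt p t.
Proof.
have [_ _ h] := ax => E1 E2; have [_ ->] := h p q E1; have [_ ->] := h q t E2.
have [_ ->] := h p t (etrans E1 E2); rewrite E1 E2; case: (s _); last exact: ltn_trans.
by move=> h1 h2; exact: ltn_trans h2 h1.
Qed.

Variable r : 'I_k -> nat.
Hypothesis r_mono : forall p q, near blk p q -> lt p q -> r p < r q.
Hypothesis pr_full : forall p q, (pr (blk p)).+2 < pr (blk q) -> exists z, pr (blk z) = (pr (blk p)).+2.
Hypothesis s_period : forall i, s i.+2 = s i.
Hypothesis pr_span : forall b c, pr b <= (pr c).+2 -> b <= c + 5.

Lemma axis_ext p : (forall z, blk z = blk p -> u z <= u p) \/ (forall z, blk z = blk p -> u p <= u z) ->
  block_ext blk r p.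
Proof.
have [inj _ h] := ax.
have r_le x y : blk x = blk y -> lt x y \/ x = y -> r x <= r y.
  move=> E [l|->] //; apply: ltnW; apply: r_mono l; by rewrite /near E leqnSn.
move=> H; have step z : blk z = blk p ->
    (if s (pr (blk p)) then (u z <= u p -> r p <= r z) /\ (u p <= u z -> r z <= r p)
     else (u z <= u p -> r z <= r p) /\ (u p <= u z -> r p <= r z)).
  move=> E; have E' : pr (blk p) = pr (blk z) by rewrite E.
  have [_ h1] := h p z E'; have [_ h2] := h z p (esym E').
  rewrite -E' in h2.
  case: (s _) h1 h2 => h1 h2; split; rewrite leq_eqVlt => /orP [/eqP /val_inj /inj ->//|l];
    apply: r_le; rewrite ?E //; left; by rewrite ?h1 ?h2.
apply/orP; case: H => H; case Es: (s (pr (blk p))); [left|right|right|left];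
  apply/forallP => z; apply/implyP => /eqP E; have := step z E; rewrite Es => -[h1 h2].
- by apply: h1; apply: H.
- by apply: h1; apply: H.
- by apply: h2; apply: H.
- by apply: h2; apply: H.
Qed.

(** Within one pair of blocks [lt] is the order of [u] or its reverse, so neighbours are
    consecutive. Neighbours from different pairs are extremal in their blocks. More than two pairs
    apart is impossible: the pair two further in than the outer point lies on the same side and
    hence between them. Two pairs amount to at most five blocks. *)
Lemma axis_succ p q : u q = (u p).+1 :> nat -> consecutive blk lt p q \/
  [/\ block_ext blk r p, block_ext blk r q, blk p <= blk q + 5 & blk q <= blk p + 5].
Proof.
have [inj h1 h2] := ax => E.
have uneq x y : pr (blk x) != pr (blk y) -> u x <> u y :> nat.
  by move=> ne /val_inj /inj E'; rewrite E' eqxx in ne.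
case: (ltngtP (pr (blk p)) (pr (blk q))) => hpr.
- right; have sp : s (pr (blk p)) by rewrite -(h1 p q hpr) E.
  split.
  + apply: axis_ext; left => z Ez; have := h1 z q; rewrite Ez sp => /(_ hpr); lia.
  + by apply: axis_ext; right => z Ez; have := h1 p z; rewrite Ez sp => /(_ hpr); lia.
  + by apply: pr_span; lia.
  + apply: pr_span; rewrite leqNgt; apply/negP => hlt.
    have [z Ez] := pr_full hlt.
    have := h1 p z; rewrite Ez sp => /(_ _); have := h1 z q; rewrite Ez s_period sp => /(_ hlt).
    move=> l1 l2; have := l2 (leqnSn _); lia.
- right; have sq : s (pr (blk q)) = false by rewrite -(h1 q p hpr); lia.
  split.
  + apply: axis_ext; left => z Ez; have := h1 q z; rewrite Ez sq => /(_ hpr).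
    have := @uneq z q; rewrite Ez => /(_ _); lia.
  + apply: axis_ext; right => z Ez; have := h1 z p; rewrite Ez sq => /(_ hpr).
    have := @uneq z p; rewrite Ez => /(_ _); lia.
  + apply: pr_span; rewrite leqNgt; apply/negP => hlt.
    have [z Ez] := pr_full hlt.
    have := h1 q z; rewrite Ez sq => /(_ (leqnSn _)); have := h1 z p; rewrite Ez s_period sq => /(_ hlt).
    have := @uneq z p; have := @uneq z q; rewrite Ez => n1 n2; lia.
  + by apply: pr_span; lia.
- left; split; first by have [] := h2 p q hpr.
  move=> z hz; have Ez : pr (blk z) = pr (blk p) by case: hz => ->.
  have [_ ->] := h2 p z (esym Ez); have [_ ->] := h2 z q (etrans Ez hpr).
  have [_ ->] := h2 q z (esym (etrans Ez hpr)); have [_ ->] := h2 z p Ez.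
  by rewrite Ez -hpr E; case: (s _); lia.
Qed.

End Axis.

Section Embedding.

Variables (k n : nat) (blk : 'I_k -> nat) (lt : rel 'I_k) (u : 'I_k -> 'I_k).
Variables (blk' : 'I_n -> nat) (lt' : rel 'I_n) (u' : 'I_n -> 'I_n).
Variables (pr : nat -> nat) (s : nat -> bool) (m : nat) (f : 'I_k -> 'I_n).
Hypothesis ax : axis blk lt u pr s.
Hypothesis ax' : axis blk' lt' u' pr s.
Hypothesis pr_shift : forall b, pr (b + 4 * m) = pr b + m.*2.
Hypothesis s_shift : forall i, s (i + m.*2) = s i.
Hypothesis blk_f : forall p, blk' (f p) = blk p + 4 * m.
Hypothesis lt_f : forall p q, near blk p q -> lt p q -> lt' (f p) (f q).

(** A shift by [4 * m] blocks is a number of full turns and keeps every pair on its side. Different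
    pairs then compare as before, and inside a pair [lt] decides. *)
Lemma axis_embed p q : (u p < u q) = (u' (f p) < u' (f q)).
Proof.
have [inj h1 h2] := ax; have [inj' h1' h2'] := ax'.
have prf x : pr (blk' (f x)) = pr (blk x) + m.*2 by rewrite blk_f pr_shift.
have lts x y : pr (blk x) < pr (blk y) -> (u x < u y) = (u' (f x) < u' (f y)).
  by move=> l; rewrite h1 // h1' !prf ?s_shift // ltn_add2r.
case: (eqVneq p q) => [->|ne]; first by rewrite !ltnn.
case: (ltngtP (pr (blk p)) (pr (blk q))) => hpr; first exact: lts.
  have := lts q p hpr; have ne1 : u p <> u q :> nat by move=> /val_inj /inj E; rewrite E eqxx in ne.
  have ne2 : u' (f p) <> u' (f q) :> nat.
    by move=> /val_inj /inj' E; have := prf p; have := prf q; rewrite E; lia.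
  lia.
have key x y : pr (blk x) = pr (blk y) -> lt x y -> (u x < u y) = (u' (f x) < u' (f y)).
  move=> E l; have [nxy e1] := h2 x y E.
  have [|_ e2] := h2' (f x) (f y); first by rewrite !prf E.
  by move: l (lt_f nxy l); rewrite e1 e2 prf s_shift; case: (s _); lia.
have /orP [l|l] := axis_total ax hpr ne; first exact: key.
have := key q p (esym hpr) l.
have ne1 : u p <> u q :> nat by move=> /val_inj /inj E; rewrite E eqxx in ne.
have ne2 : u' (f p) <> u' (f q) :> nat.
  move=> /val_inj /inj' E; have [nqp _] := h2 q p (esym hpr).
  by have := lt_f nqp l; rewrite E (negPf (axis_irr ax' _)).
lia.
Qed.

End Embedding.

Lemma half_or_uphalf b c : b <= c.+1 -> c <= b.+1 -> b./2 = c./2 \/ uphalf b = uphalf c.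
Proof. lia. Qed.

Section Spiral.

Variables (k : nat) (pi : 'S_k) (blk : 'I_k -> nat) (lt : rel 'I_k).
Hypothesis sp : spiral pi blk lt.

Lemma spiral_order : staircase_order blk lt.
Proof.
have [ax ay _] := sp; split; first exact: axis_irr ax.
- move=> p q /andP [h1 h2] ne; case: (half_or_uphalf h1 h2) => E.
    exact: axis_total ax _ _ E ne.
  exact: axis_total ay _ _ E ne.
- move=> p q t /andP [h1 h2] /andP [h3 h4] /andP [h5 h6].
  have [[E1 E2]|[E1 E2]] : ((blk p)./2 = (blk q)./2 /\ (blk q)./2 = (blk t)./2) \/
      (uphalf (blk p) = uphalf (blk q) /\ uphalf (blk q) = uphalf (blk t)) by lia.
    exact: axis_trans ax _ _ _ E1 E2.
  exact: axis_trans ay _ _ _ E1 E2.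
Qed.

Lemma spiral_adj r p q : (forall p q, near blk p q -> lt p q -> r p < r q) ->
  padj pi p q -> consecutive blk lt p q \/
  [/\ block_ext blk r p, block_ext blk r q, blk p <= blk q + 5 & blk q <= blk p + 5].
Proof.
move=> r_mono; have [ax ay full] := sp.
have swap p' q' : consecutive blk lt q' p' \/
    [/\ block_ext blk r q', block_ext blk r p', blk q' <= blk p' + 5 & blk p' <= blk q' + 5] ->
    consecutive blk lt p' q' \/
    [/\ block_ext blk r p', block_ext blk r q', blk p' <= blk q' + 5 & blk q' <= blk p' + 5].
  by case=> [/consecutive_sym|[]]; [left|right].
have full_x p' q' : ((blk p')./2).+2 < (blk q')./2 -> exists z, (blk z)./2 = ((blk p')./2).+2.
  move=> h; have [|z Ez] := full q' (((blk p')./2).+2.*2); first lia.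
  by exists z; lia.
have full_y p' q' : (uphalf (blk p')).+2 < uphalf (blk q') -> exists z, uphalf (blk z) = (uphalf (blk p')).+2.
  move=> h; have [|z Ez] := full q' ((uphalf (blk p')).+2.*2); first lia.
  by exists z; lia.
have per i : odd i.+2 = odd i by rewrite /= negbK.
have per' i : ~~ odd i.+2 = ~~ odd i by rewrite per.
have sx b c : b./2 <= (c./2).+2 -> b <= c + 5 by lia.
have sy b c : uphalf b <= (uphalf c).+2 -> b <= c + 5 by lia.
case/or4P => /eqP E.
- exact: (axis_succ ax r_mono full_x per' sx).
- apply: swap; exact: (axis_succ ax r_mono full_x per' sx).
- exact: (axis_succ ay r_mono full_y per sy).
- apply: swap; exact: (axis_succ ay r_mono full_y per sy).
Qed.

End Spiral.

Section Contain.

Variables (k n : nat) (sigma : 'S_k) (pi : 'S_n).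
Variables (blk : 'I_k -> nat) (lt : rel 'I_k) (blk' : 'I_n -> nat) (lt' : rel 'I_n).
Hypotheses (sp : spiral sigma blk lt) (sp' : spiral pi blk' lt').

Lemma spiral_contains m (f : 'I_k -> 'I_n) :
  (forall p, blk' (f p) = blk p + 4 * m) ->
  (forall p q, near blk p q -> lt p q -> lt' (f p) (f q)) -> contains pi sigma.
Proof.
move=> hb hl; have [ax ay _] := sp; have [ax' ay' _] := sp'; exists f; split.
  move=> p q; rewrite (axis_embed ax ax' _ _ hb hl) // => [b|i]; first lia.
  by rewrite oddD odd_double addbF.
move=> p q; rewrite (axis_embed ay ay' _ _ hb hl) // => [b|i]; first lia.
by rewrite oddD odd_double addbF.
Qed.

Variables (r : 'I_k -> nat) (r' : 'I_n -> nat).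
Hypothesis r_mono : forall p q, near blk p q -> lt p q -> r p < r q.
Hypothesis r'_mono : forall p q, near blk' p q -> lt' p q -> r' p < r' q.

(** The point [p] goes to the top of block [blk p + 4 * m] after [(r p).*2] steps; the doubling pays
    for two comparable points in one block. *)
Lemma spiral_window m L S : (forall p, blk p < L) -> 1 < L -> (forall p, (r p).*2 <= S) ->
  (forall Y left, is_cut blk' lt' (4 * m) (4 * m + L) Y left -> S.+1 < #|Y|) ->
  contains pi sigma.
Proof.
move=> hL L1 hS no_cut.
have st' := spiral_order sp'.
have ex p : exists y, top blk' lt' r' (4 * m) (4 * m + L) (r p).*2 (blk p + 4 * m) y.
  by apply: (top_exists st' r'_mono no_cut); have := hL p; lia.
have [f fP] : exists f, forall p,
    top blk' lt' r' (4 * m) (4 * m + L) (r p).*2 (blk p + 4 * m) (f p).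
  by exists (fun p => xchoose (ex p)) => p; exact: xchooseP.
apply: (@spiral_contains m f).
  by move=> p; have /and3P [_ /eqP] := fP p.
move=> p q npq lpq; have rpq := r_mono npq lpq.
have h1 := hL p; have h2 := hL q; have h3 := hS q; move: npq; rewrite /near => npq.
case: (eqVneq (blk p) (blk q)) => [E|ne].
  have fq := fP q; rewrite -E in fq.
  by apply: (top_same st' r'_mono no_cut) (fP p) fq; lia.
by apply: (top_adjacent st' r'_mono no_cut) (fP p) (fP q); lia.
Qed.

End Contain.

(** * The spiral of a permutation in C11 avoiding 3142 *)

Lemma contains_3142 n (pi : 'S_n) (n0 n1 n2 n3 : 'I_n) :
  n0 < n1 -> n1 < n3 -> n3 < n2 -> pi n1 < pi n2 -> pi n2 < pi n0 -> pi n0 < pi n3 ->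
  contains pi p3142.
Proof.
move=> h1 h2 h3 h4 h5 h6; exists (fun i : 'I_4 => nth n0 [:: n0; n1; n3; n2] i).
have pE (i : 'I_4) : p3142 i = nth 0 [:: 2; 0; 3; 1] i :> nat.
  by rewrite permE inordK //; case: i => [[|[|[|[|]]]]].
split=> -[[|[|[|[|a]]]] ha] -[[|[|[|[|b]]]] hb] //=; rewrite ?pE /=; lia.
Qed.

Section Arms.

Variables (k : nat) (pi : 'S_k) (A : {set 'I_k}).
Hypotheses (incA : increasing_on pi A) (decA : decreasing_on pi (~: A)).

(* The arms are numbered counterclockwise: 0 north-west, 1 south-west, 2 south-east, 3 north-east. *)
Definition arm (p : 'I_k) : nat :=
  if p \in A then if [exists d, [&& d \notin A, d < p & pi d < pi p]] then 3 else 1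
  else if [exists a, [&& a \in A, a < p & pi p < pi a]] then 2 else 0.

Variant arm_spec p : nat -> Prop :=
  | ArmNW of p \notin A & (forall a, a \in A -> a < p -> pi p < pi a -> False) : arm_spec p 0
  | ArmSW of p \in A & (forall d, d \notin A -> d < p -> pi d < pi p -> False) : arm_spec p 1
  | ArmSE a of p \notin A & a \in A & a < p & pi p < pi a : arm_spec p 2
  | ArmNE d of p \in A & d \notin A & d < p & pi d < pi p : arm_spec p 3.

Lemma armP p : arm_spec p (arm p).
Proof.
rewrite /arm; case: ifPn => pA; case: ifPn.
- by move=> /existsP [d /and3P [h1 h2 h3]]; exact: ArmNE h1 h2 h3.
- rewrite negb_exists => /forallP h; apply: ArmSW => // d h1 h2 h3.
  by have := h d; rewrite h1 h2 h3.
- by move=> /existsP [d /and3P [h1 h2 h3]]; exact: ArmSE h1 h2 h3.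
- rewrite negb_exists => /forallP h; apply: ArmNW => // d h1 h2 h3.
  by have := h d; rewrite h1 h2 h3.
Qed.

Lemma neq_val (p q : 'I_k) : p \in A -> q \notin A -> p <> q :> nat /\ pi p <> pi q :> nat.
Proof.
move=> pA qA; have ne : p <> q by move=> E; rewrite E (negPf qA) in pA.
by split=> [/val_inj|/val_inj /perm_inj].
Qed.

Lemma inc_le (p q : 'I_k) : p \in A -> q \in A -> (p < q) = (pi p < pi q).
Proof.
move=> pA qA; case: (ltngtP p q) => [l|l|/val_inj ->]; last by rewrite ltnn.
  by rewrite incA.
by have := incA qA pA l; lia.
Qed.

Lemma dec_le (p q : 'I_k) : p \notin A -> q \notin A -> (p < q) = (pi q < pi p).
Proof.
move=> pA qA; case: (ltngtP p q) => [l|l|/val_inj ->]; last by rewrite ltnn.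
  by rewrite decA ?inE.
by have := decA (_ : q \in ~: A) (_ : p \in ~: A) l; rewrite !inE pA qA => /(_ isT isT); lia.
Qed.

Lemma odd_arm p : odd (arm p) = (p \in A).
Proof. by case: armP => [/negPf ->|->|a /negPf ->|d ->]. Qed.

Lemma arm_lt4 p : arm p < 4.
Proof. by case: armP. Qed.

(** Together with [arm_bottom_top] this separates the arms by a vertical and a horizontal line,
    although no centre is ever named. *)
Lemma arm_left_right p q : arm p < 2 -> 1 < arm q -> p < q.
Proof.
case: armP => // [pD hp|pA hp] _; case: armP => // [a qD aA l1 l2|d qA dD l1 l2] _.
- case: (eqVneq p q) => [E|/eqP ne]; first by case: (hp a aA); rewrite E.
  have := dec_le pD qD; have := hp a aA.
  have : p <> q :> nat by move/val_inj.
  lia.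
- have := dec_le dD pD; have := hp q qA; have := neq_val qA pD; lia.
- have := inc_le aA pA; have := hp q qD; have := neq_val pA qD; lia.
- case: (eqVneq p q) => [E|/eqP ne]; first by case: (hp d dD); rewrite E.
  have := inc_le pA qA; have := hp d dD.
  have : p <> q :> nat by move/val_inj.
  lia.
Qed.

Lemma arm_bottom_top p q : 0 < arm p < 3 -> (arm q == 0) || (arm q == 3) -> pi p < pi q.
Proof.
case: armP => // [pA hp|a pD aA l1 l2] _; case: armP => // [qD hq|d qA dD l3 l4] _.
- have := hp q qD; have := hq p pA; have := neq_val pA qD; lia.
- case: (eqVneq p q) => [E|/eqP ne]; first by case: (hp d dD); rewrite E.
  have := inc_le pA qA; have := hp d dD.
  have : p <> q :> nat by move/val_inj.
  lia.
- case: (eqVneq p q) => [E|/eqP ne]; first by case: (hq a aA); rewrite -E.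
  have := dec_le pD qD; have := dec_le qD pD; have := hq a aA.
  have : pi p <> pi q :> nat by move/val_inj/perm_inj.
  lia.
- have := inc_le aA qA; have := dec_le dD pD; have := neq_val qA pD; lia.
Qed.

Lemma arm_mono p q : arm p = arm q -> (p < q) = if odd (arm p) then pi p < pi q else pi q < pi p.
Proof.
move=> e; have := odd_arm q; rewrite -e !odd_arm.
by case: ifPn => pA qA; [rewrite inc_le | rewrite dec_le] => //; rewrite -qA.
Qed.

(* [inner a p q]: the point [p], on the arm [a] or the next one, is closer to the centre than [q]. *)
Definition inner (a : nat) (p q : 'I_k) : bool :=
  match a %% 4 with 0 => q < p | 1 => pi q < pi p | 2 => p < q | _ => pi p < pi q end.

Lemma inner_trans a p q t : inner a p q -> inner a q t -> inner a p t.
Proof. by rewrite /inner; case: (a %% 4) => [|[|[|?]]]; lia. Qed.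

Lemma inner_total a p q : p != q -> inner a p q || inner a q p.
Proof.
move=> /eqP ne; have h1 : p <> q :> nat by move/val_inj.
have h2 : pi p <> pi q :> nat by move/val_inj/perm_inj.
by rewrite /inner; case: (a %% 4) => [|[|[|?]]]; lia.
Qed.

Lemma inner_irr a p : inner a p p = false.
Proof. by rewrite /inner; case: (a %% 4) => [|[|[|?]]]; rewrite ltnn. Qed.

Lemma inner_arm a p q : arm p = a.+1 %% 4 -> arm q = a.+1 %% 4 -> inner a.+1 p q = inner a p q.
Proof.
move=> Ep Eq; have := arm_mono (etrans Ep (esym Eq)); have := arm_mono (etrans Eq (esym Ep)).
rewrite /inner Ep Eq.
have [[-> ->]|[[-> ->]|[[-> ->]|[-> ->]]]] : (a %% 4 = 0 /\ a.+1 %% 4 = 1) \/ (a %% 4 = 1 /\ a.+1 %% 4 = 2)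
  \/ (a %% 4 = 2 /\ a.+1 %% 4 = 3) \/ (a %% 4 = 3 /\ a.+1 %% 4 = 0) by lia.
all: move=> /=; lia.
Qed.

(** Zone [j] is to collect the blocks [j], [j + 4], [j + 8] and so on of one arm, so that the block
    of a point is the last zone containing it. The first five zones are whole arms; later a point
    enters if some point of the preceding zone lies farther out. Zones 0 and 4 coincide, hence block
    0 is empty. *)
Fixpoint zone (j : nat) : {set 'I_k} :=
  if j is n.+1 then
    if n < 4 then [set q | arm q == j %% 4]
    else [set q | (arm q == j %% 4) && [exists p in zone n, inner n q p]]
  else [set q | arm q == 0].

Lemma zone_arm j p : p \in zone j -> arm p = j %% 4.
Proof.
case: j => [|j] /=; first by rewrite inE => /eqP.
by case: ifP => _; rewrite inE; [move/eqP | case/andP => /eqP].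
Qed.

Lemma zone_first j p : j < 5 -> (p \in zone j) = (arm p == j %% 4).
Proof. by case: j => [|j] /=; rewrite ?inE // ltnS => ->; rewrite inE. Qed.

Lemma zone_succP j q : 3 < j ->
  reflect (arm q = j.+1 %% 4 /\ exists2 p, p \in zone j & inner j q p) (q \in zone j.+1).
Proof.
move=> hj /=; rewrite ltnNge hj /= inE; apply: (iffP andP) => -[h1].
  by move=> /existsP [p /andP [h2 h3]]; split; [exact/eqP|exists p].
by move=> [p h2 h3]; split; [exact/eqP|apply/existsP; exists p; rewrite h2].
Qed.

Lemma zone_down j p q : p \in zone j -> arm q = arm p -> inner j q p -> q \in zone j.
Proof.
move=> pE Ea l; have Ep := zone_arm pE.
case: (ltnP j 5) => hj; first by rewrite zone_first // Ea Ep.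
case: j hj pE l Ep => // j hj /zone_succP -/(_ hj) [_ [p' p'zone l']] l Ep; apply/zone_succP => //.
split; first by rewrite Ea.
exists p' => //; apply: inner_trans l'; rewrite -inner_arm //; by rewrite ?Ea.
Qed.

Lemma zone_nested j : zone (j + 4) \subset zone j.
Proof.
elim: j => [|j IH]; apply/subsetP => p pE.
  by have := zone_arm pE; rewrite zone_first //= => ->.
case: (ltnP j 4) => hj; first by rewrite zone_first // (zone_arm pE); lia.
move: pE; rewrite addSn => /zone_succP [|Ea [q qE l]]; first lia.
apply/zone_succP => //; split; first by rewrite Ea; lia.
exists q; first exact: (subsetP IH).
by move: l; rewrite /inner modnDr.
Qed.

Hypothesis av3142 : avoids pi p3142.

(** From left to right the points are [n0], [n1], [n3], [n2], and the remaining conditions order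
    their values as 3142. *)
Lemma no_clockwise_cycle n0 n1 n2 n3 : arm n0 = 0 -> arm n1 = 1 -> arm n2 = 2 -> arm n3 = 3 ->
  inner 0 n1 n0 -> inner 1 n2 n1 -> inner 2 n3 n2 -> inner 3 n0 n3 -> False.
Proof.
move=> a0 a1 a2 a3; rewrite /inner /= => h0 h1 h2 h3; apply: av3142.
apply: (contains_3142 h0 _ h2 h1 _ h3).
  by apply: arm_left_right; rewrite ?a1 ?a3.
by apply: arm_bottom_top; rewrite ?a2 ?a0.
Qed.

Lemma no_cycle j p q1 q2 q3 : arm p = j %% 4 -> arm q1 = j.+1 %% 4 -> arm q2 = j.+2 %% 4 ->
  arm q3 = j.+3 %% 4 -> inner j q1 p -> inner j.+1 q2 q1 -> inner j.+2 q3 q2 -> inner j.+3 p q3 -> False.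
Proof.
rewrite /inner.
have [[-> [-> [-> ->]]]|[[-> [-> [-> ->]]]|[[-> [-> [-> ->]]]|[-> [-> [-> ->]]]]]] :
  (j %% 4 = 0 /\ j.+1 %% 4 = 1 /\ j.+2 %% 4 = 2 /\ j.+3 %% 4 = 3) \/
  (j %% 4 = 1 /\ j.+1 %% 4 = 2 /\ j.+2 %% 4 = 3 /\ j.+3 %% 4 = 0) \/
  (j %% 4 = 2 /\ j.+1 %% 4 = 3 /\ j.+2 %% 4 = 0 /\ j.+3 %% 4 = 1) \/
  (j %% 4 = 3 /\ j.+1 %% 4 = 0 /\ j.+2 %% 4 = 1 /\ j.+3 %% 4 = 2) by lia.
- move=> a0 a1 a2 a3 h0 h1 h2 h3; exact: (@no_clockwise_cycle p q1 q2 q3).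
- move=> a0 a1 a2 a3 h0 h1 h2 h3; exact: (@no_clockwise_cycle q3 p q1 q2).
- move=> a0 a1 a2 a3 h0 h1 h2 h3; exact: (@no_clockwise_cycle q2 q3 p q1).
- move=> a0 a1 a2 a3 h0 h1 h2 h3; exact: (@no_clockwise_cycle q1 q2 q3 p).
Qed.

(** The outermost point [z] of the zone drops out within one turn. If it came back, the turn would
    begin at [z] or farther in, and could be closed up to a forbidden cycle at [z]. *)
Lemma zone_strict j : 3 < j -> zone j != set0 -> exists2 z, z \in zone j & z \notin zone (j + 4).
Proof.
move=> hj /set0Pn [p0 p0E].
pose V p := [set q in zone j | inner j q p].
have [z zE zmax] := @arg_maxnP _ p0 (fun p => p \in zone j) (fun p => #|V p|) p0E.
have outer p : p \in zone j -> p != z -> inner j p z.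
  move=> pE ne; have := inner_total j ne => /orP [//|l].
  have zm : #|V p| <= #|V z| := zmax p pE.
  move: zm; rewrite leqNgt => /negP; case; apply: proper_card; apply/properP; split.
    apply/subsetP => x; rewrite !inE => /andP [-> lx]; exact: inner_trans lx l.
  by exists z; rewrite !inE ?zE ?inner_irr ?l.
exists z => //; apply/negP; rewrite !addnS addn0 => /zone_succP [|a4 [q3 /zone_succP [|a3 [q2 /zone_succP [|a2 [q1]]]]]].
1-3: lia.
move=> /(zone_succP _ hj) [a1 [p pE l0]] l1 l2 l3.
apply: (no_cycle (zone_arm zE) a1 a2 a3 _ l1 l2 l3).
case: (eqVneq p z) => [<- //|ne]; exact: inner_trans l0 (outer p pE ne).
Qed.

Lemma zone_bounded i j : 3 < j -> zone (j + 4 * i) = set0 \/ #|zone (j + 4 * i)| + i <= k.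
Proof.
move=> hj; elim: i => [|i [IH|IH]].
- by right; rewrite muln0 !addn0 -[X in _ <= X]card_ord max_card.
- left; apply/eqP; rewrite -subset0 -IH mulnS (addnC 4) addnA; exact: zone_nested.
- case: (eqVneq (zone (j + 4 * i)) set0) => [E0|ne].
    left; apply/eqP; rewrite -subset0 -E0 mulnS (addnC 4) addnA; exact: zone_nested.
  right; have [|z h1 h2] := @zone_strict (j + 4 * i) _ ne; first lia.
  apply: leq_trans IH; rewrite addnS ltn_add2r mulnS (addnC 4) addnA.
  apply: proper_card; apply/properP; split; first exact: zone_nested.
  by exists z.
Qed.

Lemma zone_nested_iter i j : zone (j + 4 * i) \subset zone j.
Proof.
elim: i => [|i IH]; first by rewrite muln0 addn0.
by apply: subset_trans IH; rewrite mulnS (addnC 4) addnA; exact: zone_nested.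
Qed.

Lemma blk_exists : exists blk : 'I_k -> nat, forall p, p \in zone (blk p) /\
  forall j, (p \in zone j) = (j %% 4 == arm p) && (j <= blk p).
Proof.
suff H p : exists b, p \in zone b /\ forall j, (p \in zone j) = (j %% 4 == arm p) && (j <= b).
  exact: (@fin_all_exists _ _ (fun p b => p \in zone b /\
    forall j, (p \in zone j) = (j %% 4 == arm p) && (j <= b))).
have ex : exists j, p \in zone j.
  by exists (arm p); have := arm_lt4 p => h; rewrite zone_first ?modn_small //; lia.
have ub j : p \in zone j -> j <= 4 * k + 8.
  move=> pE; rewrite leqNgt; apply/negP => h.
  have Ej : j = (4 + j %% 4) + 4 * (j %/ 4).-1 by lia.
  have [|E0|le] := @zone_bounded (j %/ 4).-1 (4 + j %% 4); first lia.
    by rewrite Ej E0 inE in pE.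
  have : 0 < #|zone j| by apply/card_gt0P; exists p.
  rewrite Ej; lia.
case: (ex_maxnP ex ub) => b bE bmax; exists b; split=> // j; apply/idP/idP => [pE|/andP [/eqP h1 h2]].
  by rewrite (zone_arm pE) eqxx bmax.
have h3 := zone_arm bE.
have Eb : b = j + 4 * ((b - j) %/ 4) by lia.
by rewrite Eb in bE; exact: (subsetP (zone_nested_iter _ _)) bE.
Qed.

Section Blocks.

Variable blk : 'I_k -> nat.
Hypothesis blkP : forall p, p \in zone (blk p) /\
  forall j, (p \in zone j) = (j %% 4 == arm p) && (j <= blk p).

Lemma blk_mod p : blk p %% 4 = arm p.
Proof. by have [/zone_arm -> _] := blkP p. Qed.

Lemma blk_gt0 p : 0 < blk p.
Proof.
case: (posnP (blk p)) => // b0; have a0 := blk_mod p; rewrite b0 in a0.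
by have [_ h] := blkP p; have := h 4; rewrite zone_first // -a0 b0.
Qed.

Lemma inner_mod a : inner (a %% 4) = inner a.
Proof. by rewrite /inner modn_mod. Qed.

Lemma notin_zone j p q : q \in zone j -> p \notin zone j -> arm p = arm q -> inner j q p.
Proof.
move=> qE pE ea; have ne : q != p by apply: contraNneq pE => <-.
have := inner_total j ne => /orP [//|l].
by rewrite (zone_down qE ea l) in pE.
Qed.

Lemma inner_same_arm p q : arm p = arm q -> blk p < blk q -> inner (arm p) q p.
Proof.
move=> ea l; have [qE _] := blkP q; have [_ h] := blkP p.
rewrite ea -blk_mod inner_mod; apply: notin_zone => //.
by rewrite h negb_and -ltnNge l orbT.
Qed.

(** The point [v] is farther in than some point of zone [blk u + 4], and [u], not belonging to that
    zone, lies outside all its points. With the lemmas before and after, this leaves adjacent arms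
    undetermined only for consecutive blocks. *)
Lemma inner_next_arm u v : arm v = (arm u).+1 %% 4 -> (blk u).+1 < blk v -> inner (arm u) v u.
Proof.
move=> ea l; have mu := blk_mod u; have mv := blk_mod v.
have [_ hu] := blkP u; have [_ hv] := blkP v.
have : v \in zone (blk u + 4).+1 by rewrite hv; lia.
move=> /zone_succP [|_ [p pE lp]]; first lia.
have -> : inner (arm u) = inner (blk u + 4) by rewrite -mu inner_mod /inner modnDr.
apply: inner_trans lp _; apply: notin_zone => //; first by rewrite hu; lia.
by rewrite (zone_arm pE); lia.
Qed.

Lemma inner_prev_arm u v : arm v = (arm u).+1 %% 4 -> blk v < (blk u).+1 -> inner (arm u) u v.
Proof.
move=> ea l; have mu := blk_mod u; have mv := blk_mod v.
have [uE _] := blkP u; have [_ hv] := blkP v; have := blk_gt0 v => v0.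
have j3 : 3 < blk u by lia.
rewrite -mu inner_mod.
have ne : u != v by apply/eqP => euv; rewrite euv in ea; lia.
have := inner_total (blk u) ne => /orP [//|l'].
have : v \in zone (blk u).+1.
  by apply/zone_succP => //; split; [lia | exists u].
by rewrite hv; lia.
Qed.

(** Near points share a column or a row and are compared by that coordinate, the inner one being
    smaller. If they share both, they lie in one block, where the two coordinates agree. *)
Definition spiral_lt (p q : 'I_k) : bool :=
  if (blk p)./2 == (blk q)./2 then if odd (blk p)./2 then p < q else q < p
  else if odd (uphalf (blk p)) then pi q < pi p else pi p < pi q.

Lemma blk_spiral : spiral pi blk spiral_lt.
Proof.
split.
- split=> // p q l; last first.
    split; first by rewrite /near; lia.
    by rewrite /spiral_lt l eqxx; case: odd.
  have mp := blk_mod p; have mq := blk_mod q.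
  have a1 := @inner_same_arm p q; have a2 := @inner_next_arm p q; have a3 := @inner_prev_arm q p.
  have b1 := @arm_left_right p q; have b2 := @arm_left_right q p.
  have c1 := @arm_mono p q; have c2 := @arm_mono q p.
  have ap := arm_lt4 p; have aq := arm_lt4 q.
  have := mp; have := mq; move: a1 a2 a3 b1 b2 c1 c2.
  rewrite /inner !(modn_small ap) !(modn_small aq).
  move: ap aq; case: (arm p) => [|[|[|[|?]]]] //; case: (arm q) => [|[|[|[|?]]]] // _ _ /=; lia.
- split.
  + exact: perm_inj.
  + move=> p q l.
    have mp := blk_mod p; have mq := blk_mod q.
    have a1 := @inner_same_arm p q; have a2 := @inner_next_arm p q; have a3 := @inner_prev_arm q p.
    have b1 := @arm_bottom_top p q; have b2 := @arm_bottom_top q p.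
    have c1 := @arm_mono p q; have c2 := @arm_mono q p.
    have ap := arm_lt4 p; have aq := arm_lt4 q.
    have := mp; have := mq; move: a1 a2 a3 b1 b2 c1 c2.
    rewrite /inner !(modn_small ap) !(modn_small aq).
    move: ap aq; case: (arm p) => [|[|[|[|?]]]] //; case: (arm q) => [|[|[|[|?]]]] // _ _ /=; lia.
  + move=> p q l; split; first by rewrite /near; lia.
    rewrite /spiral_lt; case: eqP => // l2.
    have eb : blk p = blk q by lia.
    have mp := blk_mod p; have mq := blk_mod q.
    have e : arm p = arm q by rewrite -mp -mq eb.
    have c1 := arm_mono e; have c2 := arm_mono (esym e); rewrite -e in c2.
    have := arm_lt4 p; move: mp c1 c2.
    by case: (arm p) => [|[|[|[|?]]]] //= mp c1 c2 _; do 2![case: ifP => ?]; lia.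
- move=> p j /andP [hj hjp].
  (* Each point of a later zone has a predecessor in the zone before, down to zone [j], which is
     thus nonempty; a point that it does not share with zone [j + 4] has block [j]. *)
  have [|z zE zE'] := @zone_strict j hj.
    have [] := blkP p; rewrite -(subnKC hjp) => pE _.
    move: (blk p - j) pE => d; elim: d {hjp} p => [|d IH] p.
      by rewrite addn0 => pE; apply/set0Pn; exists p.
    by rewrite addnS => /zone_succP [|_ [q qE _]]; [lia | exact: IH q qE].
  exists z; have [_ h] := blkP z; have := h j; have := h (j + 4); rewrite zE (negPf zE').
  by have := blk_mod z; lia.
Qed.

End Blocks.
End Arms.

Lemma spiral_exists n (pi : 'S_n) : perm_setI C11 (Av p3142) pi ->
  exists blk lt, spiral pi blk lt.
Proof.
move=> [[A [incA decA]] av]; have [blk blkP] := blk_exists incA decA av.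
by exists blk, (spiral_lt pi blk); exact: (blk_spiral incA decA av blkP).
Qed.

Lemma tw_avoiding (K : nat) (sigma : 'S_K) : perm_setI C11 (Av p3142) sigma ->
  exists2 w, 0 < w & forall k (pi : 'S_k), perm_setI C11 (Av p3142) pi ->
    avoids pi sigma -> tw (padj pi) w set0 setT.
Proof.
move=> /spiral_exists [blk [lt sp]].
have [r [r_bound r_mono]] := rank_exists (spiral_order sp).
(* A window has room for all blocks of [sigma], and its length is a multiple of 4, so that each
   window starts after full turns. Ranks are at most [K], hence [K.+1.*2] steps suffice, and a
   zigzag visits at most one point more than it has steps. *)
pose b := \max_p blk p; pose W := 4 * b.+2; pose c := (K.+1.*2).+1.
exists ((c + 6 * W).*2 + 2 * W + 1); first by rewrite addn1.
move=> k pi /spiral_exists [blk' [lt' sp']] av.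
have [r' [_ r'_mono]] := rank_exists (spiral_order sp').
apply: (tw_of_cuts (spiral_order sp') r'_mono (fun p q => spiral_adj sp' r'_mono)).
  by rewrite /W; lia.
move=> m; apply: NNPP => nocut; apply: av.
apply: (spiral_window sp sp' r_mono r'_mono (m := m * b.+2) (L := W) (S := K.+1.*2)).
- by move=> p; have : blk p <= b := leq_bigmax p; rewrite /W; lia.
- by rewrite /W; lia.
- by move=> p; rewrite leq_double; have := r_bound p; rewrite card_ord; lia.
move=> Y left hcut; rewrite ltnNge; apply/negP => le; apply: nocut; exists Y, left; split=> //.
have -> : m * W = 4 * (m * b.+2) by rewrite /W; lia.
by have -> : m.+1 * W = 4 * (m * b.+2) + W by rewrite /W; lia.
Qed.

Theorem theorem5 (C : perm_set)
    (hC : proper_subclass C (perm_setI C11 (Av p3142))) :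
  polynomial_time (pattern_PPM C).
Proof.
have [hclass hsub hneq] := hC.
have [K [sigma [hsigma nsigma]]] : exists n (sigma : 'S_n), perm_setI C11 (Av p3142) sigma /\ ~ C n sigma.
  apply: NNPP => h; apply: hneq => n sigma hs.
  by apply: NNPP => nC; apply: h; exists n, sigma.
have [w w_gt0 hw] := tw_avoiding hsigma.
apply: (polynomial_time_of_consistency w_gt0) => k n pi tau k0 kn pC; split.
  apply: tw_survives_contains => //; apply: hw; first exact: hsub.
  by move=> /(hclass _ _ _ _ pC).
exact: contains_survives.
Qed.
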